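(* Let $p\ge 5$ be an integer, let $\alpha\in\mathbb{C}$ be a primitive $p$-th root of unity, and consider a smooth complex map (with fixed point at the origin of $\mathbb{C}^2$) of the form $$F(x,y)=\Bigl(\alpha x+\sum_{i+j\ge 2} f_{i,j}x^iy^j,\ \frac{1}{\alpha}\,y+\sum_{i+j\ge 2} g_{i,j}x^iy^j\Bigr).$$ Then the conditions $\mathcal{P}_1(F)=\mathcal{P}_2(F)=\mathcal{P}_3(F)=0$ are necessary for $F$ to be $p$-periodic, where $$\begin{aligned}\mathcal{P}_1(F)={}&(f_{2,1}+f_{1,1}g_{1,1})\alpha^4-f_{1,1}(2f_{2,0}-g_{1,1})\alpha^3+(2g_{2,0}f_{0,2}-f_{1,1}f_{2,0}+f_{1,1}g_{1,1})\alpha^2\\&-(f_{2,1}+f_{1,1}f_{2,0})\alpha+f_{1,1}f_{2,0},\end{aligned}$$ $$\begin{aligned}\mathcal{P}_2(F)={}&g_{0,2}g_{1,1}\alpha^4-(g_{1,2}+g_{0,2}g_{1,1})\alpha^3+(f_{1,1}g_{1,1}+2g_{2,0}f_{0,2}-g_{0,2}g_{1,1})\alpha^2\\&+g_{1,1}(-2g_{0,2}+f_{1,1})\alpha+f_{1,1}g_{1,1}+g_{1,2},\end{aligned}$$ and $\mathcal{P}_3(F)=\sum_{k=0}^{17}c_k\alpha^k$, with the coefficients $c_k$ (polynomials in the $f_{i,j},g_{i,j}$) listed explicitly in the context.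
   Context: A map $F$ is called $p$-periodic if $F^p(x)=x$ for all $x$ for which $F^p$ is well defined, and $p$ is the smallest positive integer with this property. The coefficients of $\mathcal{P}_3(F)=\sum_{k=0}^{17}c_k\alpha^k$ are the following, where we abbreviate $f_{ij}:=f_{i,j}$, $g_{ij}:=g_{i,j}$ (all indices are single digits): $c_{17}=f_{11}g_{02}g_{11}^2$. $c_{16}=2g_{11}^2f_{11}g_{02}-f_{31}g_{02}-f_{11}g_{11}g_{12}-f_{11}g_{02}g_{21}$. $c_{15}=f_{32}+3g_{11}^2f_{11}g_{02}+3f_{11}g_{02}f_{30}-3f_{11}g_{02}g_{21}+2f_{11}f_{20}g_{02}g_{11}+2f_{11}^2g_{02}g_{20}-2f_{31}g_{02}+2f_{21}f_{20}g_{02}+g_{11}^2f_{12}+2f_{22}g_{11}+f_{11}g_{22}+2f_{02}f_{11}g_{11}g_{20}-f_{11}g_{11}g_{12}+g_{11}^2f_{11}^2$. $c_{14}=3g_{11}^2f_{11}g_{02}+6f_{11}g_{02}f_{30}-6f_{02}f_{30}g_{11}-4f_{12}f_{20}g_{11}-3f_{11}g_{11}f_{21}+2f_{12}g_{21}-3f_{12}f_{30}+5g_{11}^2f_{12}+2g_{11}^2f_{11}^2+2f_{02}f_{11}g_{11}g_{20}-2f_{22}f_{20}-2f_{11}^2g_{21}-3f_{31}g_{02}-2f_{11}g_{02}^2g_{20}+3f_{11}f_{20}g_{02}g_{11}+4f_{21}f_{20}g_{02}-3f_{02}f_{11}g_{30}-2f_{12}g_{02}g_{20}+4f_{22}g_{11}+f_{32}+2g_{11}^3f_{02}+2f_{02}g_{11}g_{21}-4f_{11}f_{20}^2g_{02}-4f_{11}g_{02}g_{21}+6f_{11}^2g_{02}g_{20}-3f_{11}f_{31}-2f_{11}f_{20}g_{12}-2f_{11}f_{12}g_{20}-4f_{40}f_{02}-2g_{11}^2f_{02}f_{20}+2f_{11}g_{22}$.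 $c_{13}=4f_{11}f_{20}f_{21}+4g_{11}^2f_{11}g_{02}+11f_{11}g_{02}f_{30}-12f_{02}f_{30}g_{11}+6f_{11}^2f_{20}g_{11}-10f_{12}f_{20}g_{11}-8f_{11}g_{11}f_{21}+2f_{12}g_{21}-3f_{12}f_{30}+4f_{12}f_{20}^2+3f_{11}^3g_{20}+10g_{11}^2f_{12}+g_{11}^2f_{11}^2+6f_{11}^2f_{30}-4f_{02}f_{11}g_{11}g_{20}-2f_{22}f_{20}-7f_{11}^2g_{21}+12f_{30}f_{20}f_{02}+4f_{02}f_{20}g_{02}g_{20}-f_{31}g_{02}-2f_{02}g_{02}g_{30}-6f_{11}g_{02}^2g_{20}+8f_{02}f_{11}f_{20}g_{20}+6f_{21}f_{20}g_{02}-6f_{02}f_{11}g_{30}-4f_{12}g_{02}g_{20}+6f_{22}g_{11}+f_{32}+6g_{11}^3f_{02}+3f_{11}g_{03}g_{20}+6f_{02}g_{11}g_{21}+6f_{03}g_{11}g_{20}-8f_{11}f_{20}^2g_{02}-3f_{11}g_{02}g_{21}+5f_{11}g_{11}g_{12}+8f_{02}f_{20}^2g_{11}+11f_{11}^2g_{02}g_{20}-5f_{11}f_{31}-5f_{11}f_{20}g_{12}+3f_{13}g_{20}-8f_{11}f_{12}g_{20}-4f_{40}f_{02}-12g_{11}^2f_{02}f_{20}+2f_{02}g_{31}-4f_{02}f_{20}g_{21}+3f_{11}g_{22}$. $c_{12}=6f_{11}f_{20}f_{21}+9g_{11}^2f_{11}g_{02}+7f_{11}g_{02}f_{30}-24f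_{02}f_{30}g_{11}+19f_{11}^2f_{20}g_{11}-16f_{12}f_{20}g_{11}-15f_{11}g_{11}f_{21}+4f_{12}g_{21}-5f_{12}f_{30}-8f_{02}f_{20}^3+4f_{12}f_{20}^2+12f_{11}^3g_{20}+15g_{11}^2f_{12}-5g_{11}^2f_{11}^2+12f_{11}^2f_{30}+3f_{03}g_{30}-33f_{02}f_{11}g_{11}g_{20}-2f_{22}f_{20}-13f_{11}^2g_{21}+12f_{30}f_{20}f_{02}+12f_{02}f_{20}g_{02}g_{20}+2f_{31}g_{02}-4f_{02}g_{02}g_{30}-8f_{11}g_{02}^2g_{20}-6f_{02}f_{21}g_{20}+26f_{02}f_{11}f_{20}g_{20}-14f_{11}f_{20}g_{02}g_{11}+2f_{21}f_{20}g_{02}-15f_{02}f_{11}g_{30}-2f_{12}g_{02}g_{20}+2f_{22}g_{11}-2f_{32}+16g_{11}^3f_{02}+6f_{11}g_{03}g_{20}+14f_{02}g_{11}g_{21}+12f_{03}g_{11}g_{20}-14f_{11}f_{20}^2g_{02}+3f_{11}g_{02}g_{21}+9f_{11}g_{11}g_{12}+20f_{02}f_{20}^2g_{11}-6f_{11}^2f_{20}^2+10f_{11}^2g_{02}g_{20}-7f_{11}f_{31}-9f_{11}f_{20}g_{12}+3f_{13}g_{20}-19f_{11}f_{12}g_{20}-6f_{03}f_{20}g_{20}-4f_{40}f_{02}-30g_{11}^2f_{02}f_{20}+2f_{02}g_{31}-8f_{02}f_{20}g_{21}+4f_{02}g_{02}g_{11}g_{20}+f_{11}g_{22}$. $c_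{11}=8f_{11}f_{20}f_{21}+15g_{11}^2f_{11}g_{02}+2f_{11}g_{02}f_{30}-18f_{02}f_{30}g_{11}+40f_{11}^2f_{20}g_{11}-12f_{12}f_{20}g_{11}-15f_{11}g_{11}f_{21}-2f_{12}g_{21}+4f_{12}f_{30}-8f_{02}f_{20}^3+6f_{12}f_{20}^2+29f_{11}^3g_{20}+11g_{11}^2f_{12}-16g_{11}^2f_{11}^2+21f_{11}^2f_{30}+3f_{03}g_{30}-74f_{02}f_{11}g_{11}g_{20}+4f_{22}f_{20}-16f_{11}^2g_{21}+16f_{30}f_{20}f_{02}+12f_{02}f_{20}g_{02}g_{20}+5f_{31}g_{02}-6f_{02}g_{02}g_{30}-8f_{11}g_{02}^2g_{20}-6f_{02}f_{21}g_{20}+70f_{02}f_{11}f_{20}g_{20}-35f_{11}f_{20}g_{02}g_{11}-4f_{21}f_{20}g_{02}-19f_{02}f_{11}g_{30}-4f_{22}g_{11}+4g_{12}f_{02}g_{20}-3f_{32}+24g_{11}^3f_{02}+9f_{11}g_{03}g_{20}+14f_{02}g_{11}g_{21}+18f_{03}g_{11}g_{20}-8f_{11}f_{20}^2g_{02}+6f_{11}g_{02}g_{21}+10f_{11}g_{11}g_{12}+40f_{02}f_{20}^2g_{11}-10f_{11}^2f_{20}^2-3f_{11}^2g_{02}g_{20}-8f_{11}f_{20}g_{12}+3f_{13}g_{20}-25f_{11}f_{12}g_{20}-12f_{03}f_{20}g_{20}+4f_{40}f_{02}-54g_{11}^2f_{02}f_{20}+2f_{02}g_{31}-12f_{02}f_{20}g_{21}+10f_{02}g_{02}g_{11}g_{20}-2f_{11}g_{22}$.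 $c_{10}=-2f_{11}f_{20}f_{21}+22g_{11}^2f_{11}g_{02}-9f_{11}g_{02}f_{30}-10f_{02}f_{30}g_{11}+54f_{11}^2f_{20}g_{11}+2f_{12}f_{20}g_{11}-8f_{11}g_{11}f_{21}-2f_{12}g_{21}+5f_{12}f_{30}-12f_{02}f_{20}^3-6f_{12}f_{20}^2+46f_{11}^3g_{20}+4g_{11}^2f_{12}-25g_{11}^2f_{11}^2+13f_{11}^2f_{30}+3f_{03}g_{30}-115f_{02}f_{11}g_{11}g_{20}+6f_{22}f_{20}-9f_{11}^2g_{21}-8f_{30}f_{20}f_{02}+4f_{02}f_{20}g_{02}g_{20}+5f_{31}g_{02}+2f_{02}g_{02}g_{30}-6f_{02}f_{21}g_{20}+98f_{02}f_{11}f_{20}g_{20}-52f_{11}f_{20}g_{02}g_{11}-10f_{21}f_{20}g_{02}-17f_{02}f_{11}g_{30}+8f_{12}g_{02}g_{20}-10f_{22}g_{11}+4g_{12}f_{02}g_{20}-3f_{32}+32g_{11}^3f_{02}+6f_{11}g_{03}g_{20}+12f_{02}g_{11}g_{21}-8f_{02}^2g_{20}^2+15f_{03}g_{11}g_{20}+9f_{11}g_{02}g_{21}+5f_{11}g_{11}g_{12}+40f_{02}f_{20}^2g_{11}-16f_{11}^2f_{20}^2-20f_{11}^2g_{02}g_{20}+7f_{11}f_{31}-3f_{11}f_{20}g_{12}-3f_{13}g_{20}-19f_{11}f_{12}g_{20}-12f_{03}f_{20}g_{20}+8f_{40}f_{02}-62g_{11}^2f_{02}f_{20}-2f_{02}g_{31}-4f_{02}f_{20}g_{21}+24f_{02}g_{02}g_{11}g_{20}-5f_{11}g_{22}$.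 $c_{9}=-10f_{11}f_{20}f_{21}+21g_{11}^2f_{11}g_{02}-11f_{11}g_{02}f_{30}+14f_{02}f_{30}g_{11}+53f_{11}^2f_{20}g_{11}+16f_{12}f_{20}g_{11}+5f_{11}g_{11}f_{21}-8f_{12}g_{21}+11f_{12}f_{30}+4f_{02}f_{20}^3-8f_{12}f_{20}^2+53f_{11}^3g_{20}-9g_{11}^2f_{12}-29g_{11}^2f_{11}^2+2f_{11}^2f_{30}-6f_{03}g_{30}-130f_{02}f_{11}g_{11}g_{20}+6f_{22}f_{20}+f_{11}^2g_{21}-16f_{30}f_{20}f_{02}-24f_{02}f_{20}g_{02}g_{20}+2f_{31}g_{02}+6f_{02}g_{02}g_{30}+4f_{11}g_{02}^2g_{20}+98f_{02}f_{11}f_{20}g_{20}-56f_{11}f_{20}g_{02}g_{11}-10f_{21}f_{20}g_{02}-3f_{02}f_{11}g_{30}+4f_{12}g_{02}g_{20}-10f_{22}g_{11}+4g_{12}f_{02}g_{20}+28g_{11}^3f_{02}-4f_{02}g_{11}g_{21}-8f_{02}^2g_{20}^2+3f_{03}g_{11}g_{20}+14f_{11}f_{20}^2g_{02}+3f_{11}g_{02}g_{21}-3f_{11}g_{11}g_{12}+28f_{02}f_{20}^2g_{11}-4f_{11}^2f_{20}^2-38f_{11}^2g_{02}g_{20}+13f_{11}f_{31}+5f_{11}f_{20}g_{12}-6f_{13}g_{20}-f_{11}f_{12}g_{20}+8f_{40}f_{02}-56g_{11}^2f_{02}f_{20}-4f_{02}g_{31}+4f_{02}f_{20}g_{21}+26f_{02}g_{02}g_{11}g_{20}-5f_{11}g_{22}$.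 $c_{8}=-16f_{11}f_{20}f_{21}+17g_{11}^2f_{11}g_{02}-10f_{11}g_{02}f_{30}+22f_{02}f_{30}g_{11}+36f_{11}^2f_{20}g_{11}+24f_{12}f_{20}g_{11}+15f_{11}g_{11}f_{21}-2f_{12}g_{21}+2f_{12}f_{30}+8f_{02}f_{20}^3-14f_{12}f_{20}^2+45f_{11}^3g_{20}-13g_{11}^2f_{12}-22g_{11}^2f_{11}^2-17f_{11}^2f_{30}-6f_{03}g_{30}-103f_{02}f_{11}g_{11}g_{20}+14f_{11}^2g_{21}-24f_{30}f_{20}f_{02}-f_{31}g_{02}-28f_{02}f_{20}g_{02}g_{20}+10f_{02}g_{02}g_{30}+10f_{11}g_{02}^2g_{20}+6f_{02}f_{21}g_{20}+58f_{02}f_{11}f_{20}g_{20}-41f_{11}f_{20}g_{02}g_{11}-4f_{21}f_{20}g_{02}+16f_{02}f_{11}g_{30}+6f_{12}g_{02}g_{20}-4f_{22}g_{11}+3f_{32}+22g_{11}^3f_{02}-6f_{11}g_{03}g_{20}-10f_{02}g_{11}g_{21}-8f_{02}^2g_{20}^2-9f_{03}g_{11}g_{20}+16f_{11}f_{20}^2g_{02}-8f_{11}g_{11}g_{12}-4f_{02}f_{20}^2g_{11}+6f_{11}^2f_{20}^2-36f_{11}^2g_{02}g_{20}+10f_{11}f_{31}+10f_{11}f_{20}g_{12}-6f_{13}g_{20}+20f_{11}f_{12}g_{20}+18f_{03}f_{20}g_{20}+4f_{40}f_{02}-26g_{11}^2f_{02}f_{20}-4f_{02}g_{31}+16f_{02}f_{20}g_{21}+36f_{02}g_{02}g_{11}g_{20}-2f_{11}g_{22}$.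 $c_{7}=-10f_{11}f_{20}f_{21}+8g_{11}^2f_{11}g_{02}-3f_{11}g_{02}f_{30}+24f_{02}f_{30}g_{11}+12f_{11}^2f_{20}g_{11}+14f_{12}f_{20}g_{11}+16f_{11}g_{11}f_{21}-2f_{12}g_{21}-f_{12}f_{30}+16f_{02}f_{20}^3-2f_{12}f_{20}^2+25f_{11}^3g_{20}-14g_{11}^2f_{12}-13g_{11}^2f_{11}^2-21f_{11}^2f_{30}-6f_{03}g_{30}-62f_{02}f_{11}g_{11}g_{20}-6f_{22}f_{20}+15f_{11}^2g_{21}-12f_{30}f_{20}f_{02}-28f_{02}f_{20}g_{02}g_{20}-3f_{31}g_{02}+6f_{11}g_{02}^2g_{20}+6f_{02}f_{21}g_{20}-22f_{11}f_{20}g_{02}g_{11}+2f_{21}f_{20}g_{02}+21f_{02}f_{11}g_{30}-4f_{12}g_{02}g_{20}+2f_{22}g_{11}-4g_{12}f_{02}g_{20}+3f_{32}+10g_{11}^3f_{02}-9f_{11}g_{03}g_{20}-18f_{02}g_{11}g_{21}-8f_{02}^2g_{20}^2-21f_{03}g_{11}g_{20}+12f_{11}f_{20}^2g_{02}-5f_{11}g_{02}g_{21}-9f_{11}g_{11}g_{12}-24f_{02}f_{20}^2g_{11}+20f_{11}^2f_{20}^2-29f_{11}^2g_{02}g_{20}+f_{11}f_{31}+9f_{11}f_{20}g_{12}-3f_{13}g_{20}+26f_{11}f_{12}g_{20}+18f_{03}f_{20}g_{20}-4f_{40}f_{02}-4g_{11}^2f_{02}f_{20}-2f_{02}g_{31}+12f_{02}f_{20}g_{21}+22f_{02}g_{02}g_{11}g_{20}+f_{11}g_{22}$.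 $c_{6}=2f_{11}f_{20}f_{21}+3g_{11}^2f_{11}g_{02}+f_{11}g_{02}f_{30}+12f_{02}f_{30}g_{11}-f_{11}^2f_{20}g_{11}+4f_{12}f_{20}g_{11}+11f_{11}g_{11}f_{21}+4f_{12}g_{21}-7f_{12}f_{30}+8f_{02}f_{20}^3+4f_{12}f_{20}^2+8f_{11}^3g_{20}-7g_{11}^2f_{12}-3g_{11}^2f_{11}^2-16f_{11}^2f_{30}+3f_{03}g_{30}-14f_{02}f_{11}g_{11}g_{20}-6f_{22}f_{20}+13f_{11}^2g_{21}+4f_{30}f_{20}f_{02}-2f_{31}g_{02}-2f_{02}g_{02}g_{30}+4f_{11}g_{02}^2g_{20}+6f_{02}f_{21}g_{20}-22f_{02}f_{11}f_{20}g_{20}+6f_{21}f_{20}g_{02}+20f_{02}f_{11}g_{30}-2f_{12}g_{02}g_{20}+6f_{22}g_{11}+2f_{32}+4g_{11}^3f_{02}-6f_{11}g_{03}g_{20}-10f_{02}g_{11}g_{21}-15f_{03}g_{11}g_{20}+2f_{11}f_{20}^2g_{02}-4f_{11}f_{20}g_{02}g_{11}-4g_{12}f_{02}g_{20}-3f_{11}g_{02}g_{21}-5f_{11}g_{11}g_{12}-28f_{02}f_{20}^2g_{11}+16f_{11}^2f_{20}^2-10f_{11}^2g_{02}g_{20}-5f_{11}f_{31}+5f_{11}f_{20}g_{12}+3f_{13}g_{20}+23f_{11}f_{12}g_{20}+12f_{03}f_{20}g_{20}-4f_{40}f_{02}+14g_{11}^2f_{02}f_{20}+2f_{02}g_{31}+8f_{02}f_{20}g_{21}+3f_{11}g_{22}+16f_{02}g_{02}g_{11}g_{20}$.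 $c_{5}=8f_{11}f_{20}f_{21}+2f_{11}g_{02}f_{30}+2f_{02}f_{30}g_{11}-6f_{11}^2f_{20}g_{11}-8f_{12}f_{20}g_{11}+3f_{11}g_{11}f_{21}+2f_{12}g_{21}-4f_{12}f_{30}+10f_{12}f_{20}^2-3f_{11}^3g_{20}-3g_{11}^2f_{12}-5f_{11}^2f_{30}+3f_{03}g_{30}-4f_{22}f_{20}+4f_{11}^2g_{21}+8f_{30}f_{20}f_{02}-f_{31}g_{02}+4f_{02}f_{20}g_{02}g_{20}-4f_{02}g_{02}g_{30}-30f_{02}f_{11}f_{20}g_{20}+f_{11}f_{20}g_{02}g_{11}+4f_{21}f_{20}g_{02}+6f_{02}f_{11}g_{30}-4f_{12}g_{02}g_{20}+4f_{22}g_{11}-4g_{12}f_{02}g_{20}-f_{32}-3f_{11}g_{03}g_{20}-6f_{02}g_{11}g_{21}-9f_{03}g_{11}g_{20}-4f_{11}f_{20}^2g_{02}-2f_{11}g_{02}g_{21}-2f_{11}g_{11}g_{12}+6f_{11}^2f_{20}^2-16f_{02}f_{20}^2g_{11}-3f_{11}^2g_{02}g_{20}-8f_{11}f_{31}+3f_{13}g_{20}+7f_{11}f_{12}g_{20}-6f_{03}f_{20}g_{20}-4f_{40}f_{02}+10g_{11}^2f_{02}f_{20}+2f_{02}g_{31}-4f_{02}f_{20}g_{21}+2f_{11}g_{22}$. $c_{4}=10f_{11}f_{20}f_{21}+f_{11}g_{02}f_{30}-2f_{02}f_{30}g_{11}-6f_{12}f_{20}g_{11}+2f_{12}g_{21}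-f_{12}f_{30}-4f_{02}f_{20}^3+6f_{12}f_{20}^2-2f_{11}^3g_{20}+g_{11}^2f_{11}^2+3f_{11}^2f_{30}+3f_{03}g_{30}+6f_{02}f_{11}g_{11}g_{20}+2f_{22}f_{20}+f_{11}^2g_{21}+8f_{30}f_{20}f_{02}+8f_{02}f_{20}g_{02}g_{20}-4f_{02}f_{11}f_{20}g_{20}+2f_{11}f_{20}g_{02}g_{11}+2f_{21}f_{20}g_{02}+2f_{02}f_{11}g_{30}+2f_{22}g_{11}-f_{32}-4f_{11}f_{20}^2g_{02}-4f_{11}^2f_{20}^2+2f_{11}^2g_{02}g_{20}-3f_{11}f_{31}-f_{11}f_{20}g_{12}+3f_{13}g_{20}+f_{11}f_{12}g_{20}-6f_{03}f_{20}g_{20}+6g_{11}^2f_{02}f_{20}+2f_{02}g_{31}-4f_{02}f_{20}g_{21}+f_{11}g_{22}$. $c_{3}=-f_{11}^3g_{20}+4f_{02}f_{20}^2g_{11}-f_{11}f_{20}g_{12}-8f_{11}^2f_{20}^2-2f_{11}f_{20}^2g_{02}-2f_{02}f_{11}g_{30}+f_{12}f_{30}-4f_{12}f_{20}g_{11}+2f_{22}f_{20}-f_{11}g_{11}f_{21}+2f_{11}^2f_{30}+f_{11}^2f_{20}g_{11}-f_{32}-f_{11}^2g_{21}-6f_{03}f_{20}g_{20}-4f_{02}f_{20}g_{21}-3f_{11}f_{12}g_{20}-2f_{02}f_{30}g_{11}-4f_{02}f_{20}^3-f_{11}f_{31}+2f_{11}f_{20}f_{21}$. $c_{2}=-2f_{11}^2f_{20}^2+4f_{02}f_{20}^2g_{11}+f_{12}f_{30}+f_{11}^3g_{20}+f_{11}^2f_{30}+4f_{02}f_{11}f_{20}g_{20}+2f_{22}f_{20}+f_{11}f_{31}-2f_{12}f_{20}^2+2f_{11}^2f_{20}g_{11}$.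 $c_{1}=-2f_{12}f_{20}^2-2f_{11}f_{20}f_{21}-f_{11}^2f_{30}$. $c_{0}=2f_{11}^2f_{20}^2$. *)

(* Defs.v *)
From HB Require Import structures.
From mathcomp Require Import all_boot all_order all_algebra.
From mathcomp Require Import complex.
From mathcomp Require Import all_classical all_reals all_analysis.

Set Implicit Arguments.
Unset Strict Implicit.
Unset Printing Implicit Defensive.

Import Order.TTheory GRing.Theory Num.Theory.
Import numFieldNormedType.Exports.

Local Open Scope classical_set_scope.
Local Open Scope ring_scope.
Local Open Scope complex_scope.

(* R[i] packed as a numClosedFieldType: this is what gives it (and its square)
   the norm and topology of MathComp-Analysis. *)
Definition Cx (R : realType) : numClosedFieldType := R[i].

Notation C2 R := (Cx R * Cx R)%type.

(* The values of F outside its domain U are irrelevant: F^m is well defined at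
   z when z, F z, ..., F^(m-1) z all lie in U. *)
Definition iter_defined (T : Type) (U : set T) (F : T -> T) (m : nat) (z : T) :
  Prop := forall k : nat, (k < m)%N -> U (iter k F z).

Definition iter_is_id (T : Type) (U : set T) (F : T -> T) (m : nat) : Prop :=
  forall z : T, iter_defined U F m z -> iter m F z = z.

Definition periodic_map (T : Type) (U : set T) (F : T -> T) (p : nat) : Prop :=
  [/\ (0 < p)%N, iter_is_id U F p &
      forall m : nat, (0 < m)%N -> (m < p)%N -> ~ iter_is_id U F m].

(* U is meant to be open. *)
Fixpoint Ck_on (K : numFieldType) (V W : normedModType K) (n : nat)
    (U : set V) (F : V -> W) : Prop :=
  match n with
  | 0%N => forall x : V, U x -> {for x, continuous F}
  | n'.+1 => (forall x : V, U x -> differentiable F x) /\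
             (forall v : V, Ck_on n' U (fun x => 'D_v F x))
  end.

(* C^2 in real coordinates (Re x, Im x, Re y, Im y). *)
Definition toC2 (R : realType) (q : (R * R) * (R * R)) : C2 R :=
  (q.1.1 +i* q.1.2, q.2.1 +i* q.2.2).

Definition ofC2 (R : realType) (z : C2 R) : (R * R) * (R * R) :=
  ((complex.Re z.1, complex.Im z.1), (complex.Re z.2, complex.Im z.2)).

(* Smooth means C^oo for the real structure of C^2; holomorphic maps are a
   special case. *)
Definition smooth_on (R : realType) (U : set (C2 R)) (F : C2 R -> C2 R) :
  Prop :=
  forall n : nat,
    Ck_on n (@toC2 R @^-1` U) (@ofC2 R \o F \o @toC2 R : R * R * (R * R) -> _).

(* The Taylor series of h at the origin is
     a x + b y + \sum_(i + j >= 2) c i j x^i y^j,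
   i.e. the truncation at total degree N is an o(|(x,y)|^N), for every N. This
   holds in particular when that series converges to h near the origin. *)
Definition has_expansion (R : realType) (h : C2 R -> Cx R) (a b : Cx R)
    (c : nat -> nat -> Cx R) : Prop :=
  forall N : nat,
    (fun z : C2 R =>
       h z - (a * z.1 + b * z.2 +
              \sum_(i < N.+1) \sum_(j < N.+1 | (2 <= i + j <= N)%N)
                 c i j * z.1 ^+ i * z.2 ^+ j))
    =o_ (0 : C2 R) (fun z : C2 R => `|z| ^+ N : Cx R).

Definition P1 (K : comNzRingType) (alpha : K) (f g : nat -> nat -> K) : K :=
  let f11 := f 1%N 1%N in let f20 := f 2%N 0%N in let f02 := f 0%N 2%N in
  let f21 := f 2%N 1%N in let g11 := g 1%N 1%N in let g20 := g 2%N 0%N in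
  (f21 + f11 * g11) * alpha ^+ 4
  - f11 * (2 * f20 - g11) * alpha ^+ 3
  + (2 * g20 * f02 - f11 * f20 + f11 * g11) * alpha ^+ 2
  - (f21 + f11 * f20) * alpha
  + f11 * f20.

Definition P2 (K : comNzRingType) (alpha : K) (f g : nat -> nat -> K) : K :=
  let f11 := f 1%N 1%N in let f02 := f 0%N 2%N in let g11 := g 1%N 1%N in
  let g20 := g 2%N 0%N in let g02 := g 0%N 2%N in let g12 := g 1%N 2%N in
  g02 * g11 * alpha ^+ 4
  - (g12 + g02 * g11) * alpha ^+ 3
  + (f11 * g11 + 2 * g20 * f02 - g02 * g11) * alpha ^+ 2
  + g11 * (- 2 * g02 + f11) * alpha
  + f11 * g11 + g12.

(* The k-th entry is the coefficient of alpha ^+ k. *)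
Definition P3_coefs (K : comNzRingType) (f g : nat -> nat -> K) : seq K :=
  let f02 := f 0%N 2%N in let f03 := f 0%N 3%N in let f11 := f 1%N 1%N in
  let f12 := f 1%N 2%N in let f13 := f 1%N 3%N in let f20 := f 2%N 0%N in
  let f21 := f 2%N 1%N in let f22 := f 2%N 2%N in let f30 := f 3%N 0%N in
  let f31 := f 3%N 1%N in let f32 := f 3%N 2%N in let f40 := f 4%N 0%N in
  let g02 := g 0%N 2%N in let g03 := g 0%N 3%N in let g11 := g 1%N 1%N in
  let g12 := g 1%N 2%N in let g20 := g 2%N 0%N in let g21 := g 2%N 1%N in
  let g22 := g 2%N 2%N in let g30 := g 3%N 0%N in let g31 := g 3%N 1%N in
  [:: 2 * f11 ^+ 2 * f20 ^+ 2;
     - 2 * f12 * f20 ^+ 2 - 2 * f11 * f20 * f21 - f11 ^+ 2 * f30;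
     - 2 * f11 ^+ 2 * f20 ^+ 2 + 4 * f02 * f20 ^+ 2 * g11 + f12 * f30 +
     f11 ^+ 3 * g20 + f11 ^+ 2 * f30 + 4 * f02 * f11 * f20 * g20 +
     2 * f22 * f20 + f11 * f31 - 2 * f12 * f20 ^+ 2 +
     2 * f11 ^+ 2 * f20 * g11;
     - f11 ^+ 3 * g20 + 4 * f02 * f20 ^+ 2 * g11 - f11 * f20 * g12 -
     8 * f11 ^+ 2 * f20 ^+ 2 - 2 * f11 * f20 ^+ 2 * g02 -
     2 * f02 * f11 * g30 + f12 * f30 - 4 * f12 * f20 * g11 + 2 * f22 * f20
     - f11 * g11 * f21 + 2 * f11 ^+ 2 * f30 + f11 ^+ 2 * f20 * g11 - f32 -
     f11 ^+ 2 * g21 - 6 * f03 * f20 * g20 - 4 * f02 * f20 * g21 -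
     3 * f11 * f12 * g20 - 2 * f02 * f30 * g11 - 4 * f02 * f20 ^+ 3 -
     f11 * f31 + 2 * f11 * f20 * f21;
     10 * f11 * f20 * f21 + f11 * g02 * f30 - 2 * f02 * f30 * g11 -
     6 * f12 * f20 * g11 + 2 * f12 * g21 - f12 * f30 - 4 * f02 * f20 ^+ 3 +
     6 * f12 * f20 ^+ 2 - 2 * f11 ^+ 3 * g20 + g11 ^+ 2 * f11 ^+ 2 +
     3 * f11 ^+ 2 * f30 + 3 * f03 * g30 + 6 * f02 * f11 * g11 * g20 +
     2 * f22 * f20 + f11 ^+ 2 * g21 + 8 * f30 * f20 * f02 +
     8 * f02 * f20 * g02 * g20 - 4 * f02 * f11 * f20 * g20 +
     2 * f11 * f20 * g02 * g11 + 2 * f21 * f20 * g02 + 2 * f02 * f11 * g30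
     + 2 * f22 * g11 - f32 - 4 * f11 * f20 ^+ 2 * g02 -
     4 * f11 ^+ 2 * f20 ^+ 2 + 2 * f11 ^+ 2 * g02 * g20 - 3 * f11 * f31 -
     f11 * f20 * g12 + 3 * f13 * g20 + f11 * f12 * g20 -
     6 * f03 * f20 * g20 + 6 * g11 ^+ 2 * f02 * f20 + 2 * f02 * g31 -
     4 * f02 * f20 * g21 + f11 * g22;
     8 * f11 * f20 * f21 + 2 * f11 * g02 * f30 + 2 * f02 * f30 * g11 -
     6 * f11 ^+ 2 * f20 * g11 - 8 * f12 * f20 * g11 + 3 * f11 * g11 * f21 +
     2 * f12 * g21 - 4 * f12 * f30 + 10 * f12 * f20 ^+ 2 -
     3 * f11 ^+ 3 * g20 - 3 * g11 ^+ 2 * f12 - 5 * f11 ^+ 2 * f30 +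
     3 * f03 * g30 - 4 * f22 * f20 + 4 * f11 ^+ 2 * g21 +
     8 * f30 * f20 * f02 - f31 * g02 + 4 * f02 * f20 * g02 * g20 -
     4 * f02 * g02 * g30 - 30 * f02 * f11 * f20 * g20 +
     f11 * f20 * g02 * g11 + 4 * f21 * f20 * g02 + 6 * f02 * f11 * g30 -
     4 * f12 * g02 * g20 + 4 * f22 * g11 - 4 * g12 * f02 * g20 - f32 -
     3 * f11 * g03 * g20 - 6 * f02 * g11 * g21 - 9 * f03 * g11 * g20 -
     4 * f11 * f20 ^+ 2 * g02 - 2 * f11 * g02 * g21 - 2 * f11 * g11 * g12 +
     6 * f11 ^+ 2 * f20 ^+ 2 - 16 * f02 * f20 ^+ 2 * g11 -
     3 * f11 ^+ 2 * g02 * g20 - 8 * f11 * f31 + 3 * f13 * g20 +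
     7 * f11 * f12 * g20 - 6 * f03 * f20 * g20 - 4 * f40 * f02 +
     10 * g11 ^+ 2 * f02 * f20 + 2 * f02 * g31 - 4 * f02 * f20 * g21 +
     2 * f11 * g22;
     2 * f11 * f20 * f21 + 3 * g11 ^+ 2 * f11 * g02 + f11 * g02 * f30 +
     12 * f02 * f30 * g11 - f11 ^+ 2 * f20 * g11 + 4 * f12 * f20 * g11 +
     11 * f11 * g11 * f21 + 4 * f12 * g21 - 7 * f12 * f30 +
     8 * f02 * f20 ^+ 3 + 4 * f12 * f20 ^+ 2 + 8 * f11 ^+ 3 * g20 -
     7 * g11 ^+ 2 * f12 - 3 * g11 ^+ 2 * f11 ^+ 2 - 16 * f11 ^+ 2 * f30 +
     3 * f03 * g30 - 14 * f02 * f11 * g11 * g20 - 6 * f22 * f20 +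
     13 * f11 ^+ 2 * g21 + 4 * f30 * f20 * f02 - 2 * f31 * g02 -
     2 * f02 * g02 * g30 + 4 * f11 * g02 ^+ 2 * g20 + 6 * f02 * f21 * g20 -
     22 * f02 * f11 * f20 * g20 + 6 * f21 * f20 * g02 +
     20 * f02 * f11 * g30 - 2 * f12 * g02 * g20 + 6 * f22 * g11 + 2 * f32 +
     4 * g11 ^+ 3 * f02 - 6 * f11 * g03 * g20 - 10 * f02 * g11 * g21 -
     15 * f03 * g11 * g20 + 2 * f11 * f20 ^+ 2 * g02 -
     4 * f11 * f20 * g02 * g11 - 4 * g12 * f02 * g20 - 3 * f11 * g02 * g21
     - 5 * f11 * g11 * g12 - 28 * f02 * f20 ^+ 2 * g11 +
     16 * f11 ^+ 2 * f20 ^+ 2 - 10 * f11 ^+ 2 * g02 * g20 - 5 * f11 * f31 +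
     5 * f11 * f20 * g12 + 3 * f13 * g20 + 23 * f11 * f12 * g20 +
     12 * f03 * f20 * g20 - 4 * f40 * f02 + 14 * g11 ^+ 2 * f02 * f20 +
     2 * f02 * g31 + 8 * f02 * f20 * g21 + 3 * f11 * g22 +
     16 * f02 * g02 * g11 * g20;
     - 10 * f11 * f20 * f21 + 8 * g11 ^+ 2 * f11 * g02 -
     3 * f11 * g02 * f30 + 24 * f02 * f30 * g11 + 12 * f11 ^+ 2 * f20 * g11
     + 14 * f12 * f20 * g11 + 16 * f11 * g11 * f21 - 2 * f12 * g21 -
     f12 * f30 + 16 * f02 * f20 ^+ 3 - 2 * f12 * f20 ^+ 2 +
     25 * f11 ^+ 3 * g20 - 14 * g11 ^+ 2 * f12 - 13 * g11 ^+ 2 * f11 ^+ 2 -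
     21 * f11 ^+ 2 * f30 - 6 * f03 * g30 - 62 * f02 * f11 * g11 * g20 -
     6 * f22 * f20 + 15 * f11 ^+ 2 * g21 - 12 * f30 * f20 * f02 -
     28 * f02 * f20 * g02 * g20 - 3 * f31 * g02 + 6 * f11 * g02 ^+ 2 * g20
     + 6 * f02 * f21 * g20 - 22 * f11 * f20 * g02 * g11 +
     2 * f21 * f20 * g02 + 21 * f02 * f11 * g30 - 4 * f12 * g02 * g20 +
     2 * f22 * g11 - 4 * g12 * f02 * g20 + 3 * f32 + 10 * g11 ^+ 3 * f02 -
     9 * f11 * g03 * g20 - 18 * f02 * g11 * g21 - 8 * f02 ^+ 2 * g20 ^+ 2 -
     21 * f03 * g11 * g20 + 12 * f11 * f20 ^+ 2 * g02 - 5 * f11 * g02 * g21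
     - 9 * f11 * g11 * g12 - 24 * f02 * f20 ^+ 2 * g11 +
     20 * f11 ^+ 2 * f20 ^+ 2 - 29 * f11 ^+ 2 * g02 * g20 + f11 * f31 +
     9 * f11 * f20 * g12 - 3 * f13 * g20 + 26 * f11 * f12 * g20 +
     18 * f03 * f20 * g20 - 4 * f40 * f02 - 4 * g11 ^+ 2 * f02 * f20 -
     2 * f02 * g31 + 12 * f02 * f20 * g21 + 22 * f02 * g02 * g11 * g20 +
     f11 * g22;
     - 16 * f11 * f20 * f21 + 17 * g11 ^+ 2 * f11 * g02 -
     10 * f11 * g02 * f30 + 22 * f02 * f30 * g11 +
     36 * f11 ^+ 2 * f20 * g11 + 24 * f12 * f20 * g11 +
     15 * f11 * g11 * f21 - 2 * f12 * g21 + 2 * f12 * f30 +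
     8 * f02 * f20 ^+ 3 - 14 * f12 * f20 ^+ 2 + 45 * f11 ^+ 3 * g20 -
     13 * g11 ^+ 2 * f12 - 22 * g11 ^+ 2 * f11 ^+ 2 - 17 * f11 ^+ 2 * f30 -
     6 * f03 * g30 - 103 * f02 * f11 * g11 * g20 + 14 * f11 ^+ 2 * g21 -
     24 * f30 * f20 * f02 - f31 * g02 - 28 * f02 * f20 * g02 * g20 +
     10 * f02 * g02 * g30 + 10 * f11 * g02 ^+ 2 * g20 + 6 * f02 * f21 * g20
     + 58 * f02 * f11 * f20 * g20 - 41 * f11 * f20 * g02 * g11 -
     4 * f21 * f20 * g02 + 16 * f02 * f11 * g30 + 6 * f12 * g02 * g20 -
     4 * f22 * g11 + 3 * f32 + 22 * g11 ^+ 3 * f02 - 6 * f11 * g03 * g20 -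
     10 * f02 * g11 * g21 - 8 * f02 ^+ 2 * g20 ^+ 2 - 9 * f03 * g11 * g20 +
     16 * f11 * f20 ^+ 2 * g02 - 8 * f11 * g11 * g12 -
     4 * f02 * f20 ^+ 2 * g11 + 6 * f11 ^+ 2 * f20 ^+ 2 -
     36 * f11 ^+ 2 * g02 * g20 + 10 * f11 * f31 + 10 * f11 * f20 * g12 -
     6 * f13 * g20 + 20 * f11 * f12 * g20 + 18 * f03 * f20 * g20 +
     4 * f40 * f02 - 26 * g11 ^+ 2 * f02 * f20 - 4 * f02 * g31 +
     16 * f02 * f20 * g21 + 36 * f02 * g02 * g11 * g20 - 2 * f11 * g22;
     - 10 * f11 * f20 * f21 + 21 * g11 ^+ 2 * f11 * g02 -
     11 * f11 * g02 * f30 + 14 * f02 * f30 * g11 +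
     53 * f11 ^+ 2 * f20 * g11 + 16 * f12 * f20 * g11 + 5 * f11 * g11 * f21
     - 8 * f12 * g21 + 11 * f12 * f30 + 4 * f02 * f20 ^+ 3 -
     8 * f12 * f20 ^+ 2 + 53 * f11 ^+ 3 * g20 - 9 * g11 ^+ 2 * f12 -
     29 * g11 ^+ 2 * f11 ^+ 2 + 2 * f11 ^+ 2 * f30 - 6 * f03 * g30 -
     130 * f02 * f11 * g11 * g20 + 6 * f22 * f20 + f11 ^+ 2 * g21 -
     16 * f30 * f20 * f02 - 24 * f02 * f20 * g02 * g20 + 2 * f31 * g02 +
     6 * f02 * g02 * g30 + 4 * f11 * g02 ^+ 2 * g20 +
     98 * f02 * f11 * f20 * g20 - 56 * f11 * f20 * g02 * g11 -
     10 * f21 * f20 * g02 - 3 * f02 * f11 * g30 + 4 * f12 * g02 * g20 -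
     10 * f22 * g11 + 4 * g12 * f02 * g20 + 28 * g11 ^+ 3 * f02 -
     4 * f02 * g11 * g21 - 8 * f02 ^+ 2 * g20 ^+ 2 + 3 * f03 * g11 * g20 +
     14 * f11 * f20 ^+ 2 * g02 + 3 * f11 * g02 * g21 - 3 * f11 * g11 * g12
     + 28 * f02 * f20 ^+ 2 * g11 - 4 * f11 ^+ 2 * f20 ^+ 2 -
     38 * f11 ^+ 2 * g02 * g20 + 13 * f11 * f31 + 5 * f11 * f20 * g12 -
     6 * f13 * g20 - f11 * f12 * g20 + 8 * f40 * f02 -
     56 * g11 ^+ 2 * f02 * f20 - 4 * f02 * g31 + 4 * f02 * f20 * g21 +
     26 * f02 * g02 * g11 * g20 - 5 * f11 * g22;
     - 2 * f11 * f20 * f21 + 22 * g11 ^+ 2 * f11 * g02 -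
     9 * f11 * g02 * f30 - 10 * f02 * f30 * g11 + 54 * f11 ^+ 2 * f20 * g11
     + 2 * f12 * f20 * g11 - 8 * f11 * g11 * f21 - 2 * f12 * g21 +
     5 * f12 * f30 - 12 * f02 * f20 ^+ 3 - 6 * f12 * f20 ^+ 2 +
     46 * f11 ^+ 3 * g20 + 4 * g11 ^+ 2 * f12 - 25 * g11 ^+ 2 * f11 ^+ 2 +
     13 * f11 ^+ 2 * f30 + 3 * f03 * g30 - 115 * f02 * f11 * g11 * g20 +
     6 * f22 * f20 - 9 * f11 ^+ 2 * g21 - 8 * f30 * f20 * f02 +
     4 * f02 * f20 * g02 * g20 + 5 * f31 * g02 + 2 * f02 * g02 * g30 -
     6 * f02 * f21 * g20 + 98 * f02 * f11 * f20 * g20 -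
     52 * f11 * f20 * g02 * g11 - 10 * f21 * f20 * g02 -
     17 * f02 * f11 * g30 + 8 * f12 * g02 * g20 - 10 * f22 * g11 +
     4 * g12 * f02 * g20 - 3 * f32 + 32 * g11 ^+ 3 * f02 +
     6 * f11 * g03 * g20 + 12 * f02 * g11 * g21 - 8 * f02 ^+ 2 * g20 ^+ 2 +
     15 * f03 * g11 * g20 + 9 * f11 * g02 * g21 + 5 * f11 * g11 * g12 +
     40 * f02 * f20 ^+ 2 * g11 - 16 * f11 ^+ 2 * f20 ^+ 2 -
     20 * f11 ^+ 2 * g02 * g20 + 7 * f11 * f31 - 3 * f11 * f20 * g12 -
     3 * f13 * g20 - 19 * f11 * f12 * g20 - 12 * f03 * f20 * g20 +
     8 * f40 * f02 - 62 * g11 ^+ 2 * f02 * f20 - 2 * f02 * g31 -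
     4 * f02 * f20 * g21 + 24 * f02 * g02 * g11 * g20 - 5 * f11 * g22;
     8 * f11 * f20 * f21 + 15 * g11 ^+ 2 * f11 * g02 + 2 * f11 * g02 * f30
     - 18 * f02 * f30 * g11 + 40 * f11 ^+ 2 * f20 * g11 -
     12 * f12 * f20 * g11 - 15 * f11 * g11 * f21 - 2 * f12 * g21 +
     4 * f12 * f30 - 8 * f02 * f20 ^+ 3 + 6 * f12 * f20 ^+ 2 +
     29 * f11 ^+ 3 * g20 + 11 * g11 ^+ 2 * f12 - 16 * g11 ^+ 2 * f11 ^+ 2 +
     21 * f11 ^+ 2 * f30 + 3 * f03 * g30 - 74 * f02 * f11 * g11 * g20 +
     4 * f22 * f20 - 16 * f11 ^+ 2 * g21 + 16 * f30 * f20 * f02 +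
     12 * f02 * f20 * g02 * g20 + 5 * f31 * g02 - 6 * f02 * g02 * g30 -
     8 * f11 * g02 ^+ 2 * g20 - 6 * f02 * f21 * g20 +
     70 * f02 * f11 * f20 * g20 - 35 * f11 * f20 * g02 * g11 -
     4 * f21 * f20 * g02 - 19 * f02 * f11 * g30 - 4 * f22 * g11 +
     4 * g12 * f02 * g20 - 3 * f32 + 24 * g11 ^+ 3 * f02 +
     9 * f11 * g03 * g20 + 14 * f02 * g11 * g21 + 18 * f03 * g11 * g20 -
     8 * f11 * f20 ^+ 2 * g02 + 6 * f11 * g02 * g21 + 10 * f11 * g11 * g12
     + 40 * f02 * f20 ^+ 2 * g11 - 10 * f11 ^+ 2 * f20 ^+ 2 -
     3 * f11 ^+ 2 * g02 * g20 - 8 * f11 * f20 * g12 + 3 * f13 * g20 -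
     25 * f11 * f12 * g20 - 12 * f03 * f20 * g20 + 4 * f40 * f02 -
     54 * g11 ^+ 2 * f02 * f20 + 2 * f02 * g31 - 12 * f02 * f20 * g21 +
     10 * f02 * g02 * g11 * g20 - 2 * f11 * g22;
     6 * f11 * f20 * f21 + 9 * g11 ^+ 2 * f11 * g02 + 7 * f11 * g02 * f30 -
     24 * f02 * f30 * g11 + 19 * f11 ^+ 2 * f20 * g11 -
     16 * f12 * f20 * g11 - 15 * f11 * g11 * f21 + 4 * f12 * g21 -
     5 * f12 * f30 - 8 * f02 * f20 ^+ 3 + 4 * f12 * f20 ^+ 2 +
     12 * f11 ^+ 3 * g20 + 15 * g11 ^+ 2 * f12 - 5 * g11 ^+ 2 * f11 ^+ 2 +
     12 * f11 ^+ 2 * f30 + 3 * f03 * g30 - 33 * f02 * f11 * g11 * g20 -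
     2 * f22 * f20 - 13 * f11 ^+ 2 * g21 + 12 * f30 * f20 * f02 +
     12 * f02 * f20 * g02 * g20 + 2 * f31 * g02 - 4 * f02 * g02 * g30 -
     8 * f11 * g02 ^+ 2 * g20 - 6 * f02 * f21 * g20 +
     26 * f02 * f11 * f20 * g20 - 14 * f11 * f20 * g02 * g11 +
     2 * f21 * f20 * g02 - 15 * f02 * f11 * g30 - 2 * f12 * g02 * g20 +
     2 * f22 * g11 - 2 * f32 + 16 * g11 ^+ 3 * f02 + 6 * f11 * g03 * g20 +
     14 * f02 * g11 * g21 + 12 * f03 * g11 * g20 -
     14 * f11 * f20 ^+ 2 * g02 + 3 * f11 * g02 * g21 + 9 * f11 * g11 * g12
     + 20 * f02 * f20 ^+ 2 * g11 - 6 * f11 ^+ 2 * f20 ^+ 2 +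
     10 * f11 ^+ 2 * g02 * g20 - 7 * f11 * f31 - 9 * f11 * f20 * g12 +
     3 * f13 * g20 - 19 * f11 * f12 * g20 - 6 * f03 * f20 * g20 -
     4 * f40 * f02 - 30 * g11 ^+ 2 * f02 * f20 + 2 * f02 * g31 -
     8 * f02 * f20 * g21 + 4 * f02 * g02 * g11 * g20 + f11 * g22;
     4 * f11 * f20 * f21 + 4 * g11 ^+ 2 * f11 * g02 + 11 * f11 * g02 * f30
     - 12 * f02 * f30 * g11 + 6 * f11 ^+ 2 * f20 * g11 -
     10 * f12 * f20 * g11 - 8 * f11 * g11 * f21 + 2 * f12 * g21 -
     3 * f12 * f30 + 4 * f12 * f20 ^+ 2 + 3 * f11 ^+ 3 * g20 +
     10 * g11 ^+ 2 * f12 + g11 ^+ 2 * f11 ^+ 2 + 6 * f11 ^+ 2 * f30 -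
     4 * f02 * f11 * g11 * g20 - 2 * f22 * f20 - 7 * f11 ^+ 2 * g21 +
     12 * f30 * f20 * f02 + 4 * f02 * f20 * g02 * g20 - f31 * g02 -
     2 * f02 * g02 * g30 - 6 * f11 * g02 ^+ 2 * g20 +
     8 * f02 * f11 * f20 * g20 + 6 * f21 * f20 * g02 - 6 * f02 * f11 * g30
     - 4 * f12 * g02 * g20 + 6 * f22 * g11 + f32 + 6 * g11 ^+ 3 * f02 +
     3 * f11 * g03 * g20 + 6 * f02 * g11 * g21 + 6 * f03 * g11 * g20 -
     8 * f11 * f20 ^+ 2 * g02 - 3 * f11 * g02 * g21 + 5 * f11 * g11 * g12 +
     8 * f02 * f20 ^+ 2 * g11 + 11 * f11 ^+ 2 * g02 * g20 - 5 * f11 * f31 -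
     5 * f11 * f20 * g12 + 3 * f13 * g20 - 8 * f11 * f12 * g20 -
     4 * f40 * f02 - 12 * g11 ^+ 2 * f02 * f20 + 2 * f02 * g31 -
     4 * f02 * f20 * g21 + 3 * f11 * g22;
     3 * g11 ^+ 2 * f11 * g02 + 6 * f11 * g02 * f30 - 6 * f02 * f30 * g11 -
     4 * f12 * f20 * g11 - 3 * f11 * g11 * f21 + 2 * f12 * g21 -
     3 * f12 * f30 + 5 * g11 ^+ 2 * f12 + 2 * g11 ^+ 2 * f11 ^+ 2 +
     2 * f02 * f11 * g11 * g20 - 2 * f22 * f20 - 2 * f11 ^+ 2 * g21 -
     3 * f31 * g02 - 2 * f11 * g02 ^+ 2 * g20 + 3 * f11 * f20 * g02 * g11 +
     4 * f21 * f20 * g02 - 3 * f02 * f11 * g30 - 2 * f12 * g02 * g20 +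
     4 * f22 * g11 + f32 + 2 * g11 ^+ 3 * f02 + 2 * f02 * g11 * g21 -
     4 * f11 * f20 ^+ 2 * g02 - 4 * f11 * g02 * g21 +
     6 * f11 ^+ 2 * g02 * g20 - 3 * f11 * f31 - 2 * f11 * f20 * g12 -
     2 * f11 * f12 * g20 - 4 * f40 * f02 - 2 * g11 ^+ 2 * f02 * f20 +
     2 * f11 * g22;
     f32 + 3 * g11 ^+ 2 * f11 * g02 + 3 * f11 * g02 * f30 -
     3 * f11 * g02 * g21 + 2 * f11 * f20 * g02 * g11 +
     2 * f11 ^+ 2 * g02 * g20 - 2 * f31 * g02 + 2 * f21 * f20 * g02 +
     g11 ^+ 2 * f12 + 2 * f22 * g11 + f11 * g22 + 2 * f02 * f11 * g11 * g20
     - f11 * g11 * g12 + g11 ^+ 2 * f11 ^+ 2;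
     2 * g11 ^+ 2 * f11 * g02 - f31 * g02 - f11 * g11 * g12 -
     f11 * g02 * g21;
     f11 * g02 * g11 ^+ 2].

Definition P3 (K : comNzRingType) (alpha : K) (f g : nat -> nat -> K) : K :=
  \sum_(k < 18) (P3_coefs f g)`_k * alpha ^+ k.

(* Main.v *)
Require Import Defs.
From mathcomp Require Import all_boot all_order all_algebra.
From mathcomp Require Import complex.
From mathcomp Require Import all_classical all_reals all_analysis.
From mathcomp Require Import ring.

(* A p-periodic F is linearized near the origin by averaging: for a coordinate
   h of eigenvalue l, Phi = 1/p \sum_(k < p) l^-k h o F^k satisfies
   Phi o F = l Phi. Comparing the Taylor coefficients of both sides up to
   degree 5, the coefficient of x^m y^n expresses f_(m,n) (or g_(m,n)) as a
   polynomial in the coefficients of Phi and the remaining data; after these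
   substitutions P1 and P2 vanish identically in the coefficients of Phi, and
   (1 - alpha^3) P3 is a multiple of P2. *)

Set Implicit Arguments.
Unset Strict Implicit.
Unset Printing Implicit Defensive.

Import Order.TTheory GRing.Theory Num.Theory.
Import numFieldNormedType.Exports.

Local Open Scope classical_set_scope.
Local Open Scope ring_scope.

(** * Polynomials in two variables *)

Section Bivariate.
Variable K : comNzRingType.
Implicit Types A B P Q : {poly {poly K}}.

(* The coefficient of x^i y^j; x is the inner variable and y the outer one. *)
Definition coef2 P i j : K := P`_j`_i.

(** Substitution of [A] for x and [B] for y in [P], spelled out as a sum of monomials so that
    coefficients and jets can be taken term by term. *)
Definition comp2 P A B : {poly {poly K}} :=
  \sum_(j < size P) \sum_(i < size P`_j)
    (coef2 P i j)%:P%:P * (A ^+ i * B ^+ j).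

Lemma coef2D P Q i j : coef2 (P + Q) i j = coef2 P i j + coef2 Q i j.
Proof. by rewrite /coef2 !coefD. Qed.

Lemma coef2Z c P i j : coef2 (c%:P%:P * P) i j = c * coef2 P i j.
Proof. by rewrite /coef2 !coefCM. Qed.

Lemma coef2_sum I (r : seq I) (S : pred I) (G : I -> {poly {poly K}}) i j :
  coef2 (\sum_(k <- r | S k) G k) i j = \sum_(k <- r | S k) coef2 (G k) i j.
Proof. by rewrite /coef2 !coef_sum. Qed.

Lemma coef2M P Q m n : coef2 (P * Q) m n =
  \sum_(j < n.+1) \sum_(i < m.+1) coef2 P i j * coef2 Q (m - i) (n - j).
Proof.
rewrite /coef2 coefM coef_sum; apply: eq_bigr => j _.
by rewrite coefM.
Qed.

Lemma coef2_1 i j : coef2 1 i j = ((i == 0) && (j == 0))%:R.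
Proof.
by rewrite /coef2 coef1; case: j => [|j]; rewrite ?coef1 ?coef0 ?andbT ?andbF.
Qed.

Lemma coef2_X i j : coef2 'X%:P i j = ((i == 1) && (j == 0))%N%:R.
Proof.
by rewrite /coef2 coefC; case: j => [|j]; rewrite ?coefX ?coef0 ?andbT ?andbF.
Qed.

Lemma coef2_Y i j : coef2 'X i j = ((i == 0) && (j == 1))%N%:R.
Proof.
by rewrite /coef2 coefX; case: (j == 1)%N; rewrite ?coef1 ?coef0 ?andbT ?andbF.
Qed.

(** Membership of [P] in the [d]-th power of the ideal (x, y). *)
Definition has_order d P := forall i j, (i + j < d)%N -> coef2 P i j = 0.

Lemma has_orderM d e P Q :
  has_order d P -> has_order e Q -> has_order (d + e) (P * Q).
Proof.
move=> hP hQ m n mn; rewrite coef2M big1 // => -[j /= hj] _.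
rewrite big1 // => -[i /= hi] _.
have [ij|ij] := ltnP (i + j) d; first by rewrite hP // mul0r.
rewrite hQ ?mulr0 // -(ltn_add2l (i + j)).
apply: leq_ltn_trans (leq_trans mn _); last by rewrite leq_add2r.
by rewrite addnACA !subnKC.
Qed.

Lemma has_orderX P n : has_order 1 P -> has_order n (P ^+ n).
Proof.
move=> hP; elim: n => [//|n IH]; rewrite exprS.
exact: (has_orderM hP IH).
Qed.

Lemma coef2_monom_small A B i j m n :
  has_order 1 A -> has_order 1 B -> (m + n < i + j)%N ->
  coef2 (A ^+ i * B ^+ j) m n = 0.
Proof.
move=> hA hB; apply: has_orderM; exact: has_orderX.
Qed.

(** Since [A] and [B] have no constant term, [A ^+ i * B ^+ j] has order i + j, so only the triangle
    i + j <= [N] contributes, whatever the size of [P]. *)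
Lemma coef2_comp2 A B P m n N :
  has_order 1 A -> has_order 1 B -> (m + n <= N)%N ->
  coef2 (comp2 P A B) m n =
  \sum_(j < N.+1) \sum_(i < (N - j).+1)
    coef2 P i j * coef2 (A ^+ i * B ^+ j) m n.
Proof.
move=> hA hB mnN.
have widen (u v : nat) (G : nat -> K) : (u <= v)%N ->
    (forall k, (u <= k)%N -> G k = 0) ->
    \sum_(k < u) G k = \sum_(k < v) G k.
  move=> uv G0; rewrite (big_ord_widen _ _ uv) big_mkcond /=.
  by apply: eq_bigr => k _; case: ltnP => // /G0.
(* [M] dominates every summation range in play, so both double sums can be padded with zeros to the
   same square. *)
pose M := maxn N.+1 (maxn (size P) (\max_(j < size P) size (P`_j)%R)).
pose S i j := coef2 P i j * coef2 (A ^+ i * B ^+ j) m n.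
have S0 i j : (N < i + j)%N -> S i j = 0.
  by move=> ij; rewrite /S coef2_monom_small ?mulr0 //; apply: leq_ltn_trans ij.
transitivity (\sum_(j < M) \sum_(i < M) S i j).
  rewrite coef2_sum.
  transitivity (\sum_(j < size P) \sum_(i < M) S i j).
    apply: eq_bigr => j _; rewrite coef2_sum.
    rewrite -(widen (size P`_j) M (fun i => S i j)).
    - by apply: eq_bigr => i _; rewrite coef2Z.
    - rewrite /M !leq_max; apply/orP; right; apply/orP; right.
      exact: (leq_bigmax j).
    - by move=> k hk; rewrite /S /coef2 nth_default ?mul0r.
  apply: (widen _ _ (fun j => \sum_(i < M) S i j)).
    by rewrite /M !leq_max leqnn orbT.
  move=> j hj; rewrite big1 // => i _.
  by rewrite /S /coef2 [P`_j]nth_default // coef0 mul0r.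
symmetry; transitivity (\sum_(j < N.+1) \sum_(i < M) S i j).
  apply: eq_bigr => j _; apply: (widen _ _ (fun i => S i j)).
    by rewrite /M leq_max ltnS leq_subr.
  move=> k hk; have jN : (j <= N)%N by rewrite -ltnS.
  by rewrite S0 // addnC -ltn_subLR.
apply: (widen _ _ (fun j => \sum_(i < M) S i j)); first by rewrite leq_maxl.
move=> j hj; rewrite big1 // => i _.
by rewrite S0 // (leq_trans hj) // leq_addl.
Qed.

(* csum and the operations below compute, unlike \sum: cbv turns their values
   at closed indices into expressions that ring can handle. *)
Fixpoint csum (h : nat -> K) n := if n is n'.+1 then csum h n' + h n else h 0%N.

Lemma csumE h n : csum h n = \sum_(i < n.+1) h i.
Proof. by elim: n => [|n IH]; rewrite ?big_ord1 // big_ord_recr /= -IH. Qed.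

Definition cauchy (s t : nat -> nat -> K) m n :=
  csum (fun j => csum (fun i => s i j * t (m - i)%N (n - j)%N) m) n.

Definition unit_coef i j : K :=
  match i, j with 0, 0 => 1 | _, _ => 0 end.

Definition monom_coef (s t : nat -> nat -> K) i j :=
  iter i (cauchy s) (iter j (cauchy t) unit_coef).

Lemma coef2M_cauchy N P s t Q :
  (forall i j, (i + j <= N)%N -> coef2 P i j = s i j) ->
  (forall i j, (i + j <= N)%N -> coef2 Q i j = t i j) ->
  forall i j, (i + j <= N)%N -> coef2 (P * Q) i j = cauchy s t i j.
Proof.
move=> hP hQ m n mn; rewrite coef2M /cauchy csumE.
apply: eq_bigr => -[j /= hj] _; rewrite csumE.
apply: eq_bigr => -[i /= hi] _.
by rewrite hP ?hQ // (leq_trans _ mn) // leq_add ?leq_subr.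
Qed.

Lemma coef2_monomE N A B s t :
  (forall i j, (i + j <= N)%N -> coef2 A i j = s i j) ->
  (forall i j, (i + j <= N)%N -> coef2 B i j = t i j) ->
  forall k l i j, (i + j <= N)%N ->
  coef2 (A ^+ k * B ^+ l) i j = monom_coef s t k l i j.
Proof.
move=> hA hB; elim=> [|k IH] l.
  rewrite mul1r; elim: l => [|l IH] i j ij.
    by rewrite coef2_1; case: i j {ij} => [|i] [|j].
  by rewrite exprS (coef2M_cauchy hB IH).
by move=> i j ij; rewrite exprS -mulrA (coef2M_cauchy hA (IH l)).
Qed.

End Bivariate.

(** The inner bound restricts to i + j <= m + n, which loses nothing when [s] and [t] have zero
    constant term. *)
Definition comp2_coef (K : comNzRingType) (u s t : nat -> nat -> K) m n :=
  csum (fun j => csum (fun i => u i j * monom_coef s t i j m n) (m + n - j))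
    (m + n).

(** Expansion data count only from degree 2 on: the lower entries of [f] are overridden by a zero
    constant term and the linear part a x + b y. *)
Definition lin_coef (K : comNzRingType) (a b : K) (f : nat -> nat -> K) i j :=
  match i, j with 0, 0 => 0 | 1, 0 => a | 0, 1 => b | _, _ => f i j end.

Ltac expand_comp2 :=
  cbv [comp2_coef csum monom_coef lin_coef iter cauchy unit_coef
       subn subn_rec Nat.sub addn addn_rec Nat.add].

(** * Coefficientwise consequences of the linearization *)

(** Lets [ring] solve [l = r] for an unknown of coefficient 1 in [l - r]. Below, [f m n] or [g m n]
    is such an unknown because Phi has linear part x or y. *)
Lemma eq_of_subr_eq (V : zmodType) (x y l r : V) :
  l = r -> x - y = l - r -> x = y.
Proof. by move=> ->; rewrite subrr => /eqP; rewrite subr_eq0 => /eqP. Qed.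

Section Obstructions.
Variables (K : comNzRingType) (a b : K) (f g u v : nat -> nat -> K).
Hypothesis ab : a * b = 1.
Hypothesis conj1 : forall m n, (m + n <= 5)%N ->
  comp2_coef (lin_coef 1 0 u) (lin_coef a 0 f) (lin_coef 0 b g) m n =
  a * lin_coef 1 0 u m n.
Hypothesis conj2 : forall m n, (m + n <= 5)%N ->
  comp2_coef (lin_coef 0 1 v) (lin_coef a 0 f) (lin_coef 0 b g) m n =
  b * lin_coef 0 1 v m n.

(** In general the equation at x^m y^n reads f_(m,n) + a^m b^n u_(m,n) + (terms in coefficients of
    lower degree) = a u_(m,n). *)
Lemma conj1_20 : f 2 0 =
  a * u 2 0 - a ^+ 2 * u 2 0.
Proof.
apply: (eq_of_subr_eq (conj1 (m := 2) (n := 0) isT)); expand_comp2.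
by ring: ab.
Qed.

Lemma conj1_11 : f 1 1 =
  - u 1 1 + a * u 1 1.
Proof.
apply: (eq_of_subr_eq (conj1 (m := 1) (n := 1) isT)); expand_comp2.
by ring: ab.
Qed.

Lemma conj1_02 : f 0 2 =
  - b ^+ 2 * u 0 2 + a * u 0 2.
Proof.
apply: (eq_of_subr_eq (conj1 (m := 0) (n := 2) isT)); expand_comp2.
by ring: ab.
Qed.

Lemma conj1_30 : f 3 0 =
  a * u 3 0 - a ^+ 3 * u 3 0 - 2 * a * f 2 0 * u 2 0 - a * g 2 0 * u 1 1.
Proof.
apply: (eq_of_subr_eq (conj1 (m := 3) (n := 0) isT)); expand_comp2.
by ring: ab.
Qed.

(** Resonance: a^2 b = a, so [u 2 1] cancels and the equation becomes a constraint in the degree 2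
    coefficients. This is the source of [P1]. *)
Lemma conj1_21 : f 2 1 =
  - b * f 2 0 * u 1 1 - 2 * b * g 2 0 * u 0 2 - 2 * a * f 1 1 * u 2 0
  - a * g 1 1 * u 1 1.
Proof.
apply: (eq_of_subr_eq (conj1 (m := 2) (n := 1) isT)); expand_comp2.
by ring: ab.
Qed.

Lemma conj1_12 : f 1 2 =
  - b * u 1 2 + a * u 1 2 - b * f 1 1 * u 1 1 - 2 * b * g 1 1 * u 0 2
  - 2 * a * f 0 2 * u 2 0 - a * g 0 2 * u 1 1.
Proof.
apply: (eq_of_subr_eq (conj1 (m := 1) (n := 2) isT)); expand_comp2.
by ring: ab.
Qed.

Lemma conj1_03 : f 0 3 =
  - b ^+ 3 * u 0 3 + a * u 0 3 - b * f 0 2 * u 1 1 - 2 * b * g 0 2 * u 0 2.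
Proof.
apply: (eq_of_subr_eq (conj1 (m := 0) (n := 3) isT)); expand_comp2.
by ring: ab.
Qed.

Lemma conj1_40 : f 4 0 =
  a * u 4 0 - a ^+ 4 * u 4 0 - f 2 0 ^+ 2 * u 2 0 - g 2 0 ^+ 2 * u 0 2
  - 2 * a * f 3 0 * u 2 0 - a * g 3 0 * u 1 1 - 3 * a ^+ 2 * f 2 0 * u 3 0
  - a ^+ 2 * g 2 0 * u 2 1 - f 2 0 * g 2 0 * u 1 1.
Proof.
apply: (eq_of_subr_eq (conj1 (m := 4) (n := 0) isT)); expand_comp2.
by ring: ab.
Qed.

Lemma conj1_31 : f 3 1 =
  a * u 3 1 - a ^+ 2 * u 3 1 - 2 * f 2 0 * u 2 1 - 2 * g 2 0 * u 1 2
  - b * f 3 0 * u 1 1 - 2 * b * g 3 0 * u 0 2 - 2 * a * f 2 1 * u 2 0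
  - a * g 2 1 * u 1 1 - 3 * a ^+ 2 * f 1 1 * u 3 0 - a ^+ 2 * g 1 1 * u 2 1
  - 2 * f 1 1 * f 2 0 * u 2 0 - f 1 1 * g 2 0 * u 1 1 - f 2 0 * g 1 1 * u 1 1
  - 2 * g 1 1 * g 2 0 * u 0 2.
Proof.
apply: (eq_of_subr_eq (conj1 (m := 3) (n := 1) isT)); expand_comp2.
by ring: ab.
Qed.

Lemma conj1_22 : f 2 2 =
  - u 2 2 + a * u 2 2 - 2 * f 1 1 * u 2 1 - f 1 1 ^+ 2 * u 2 0
  - 2 * g 1 1 * u 1 2 - g 1 1 ^+ 2 * u 0 2 - b ^+ 2 * f 2 0 * u 1 2
  - 3 * b ^+ 2 * g 2 0 * u 0 3 - b * f 2 1 * u 1 1 - 2 * b * g 2 1 * u 0 2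
  - 2 * a * f 1 2 * u 2 0 - a * g 1 2 * u 1 1 - 3 * a ^+ 2 * f 0 2 * u 3 0
  - a ^+ 2 * g 0 2 * u 2 1 - 2 * f 0 2 * f 2 0 * u 2 0 - f 0 2 * g 2 0 * u 1 1
  - f 1 1 * g 1 1 * u 1 1 - f 2 0 * g 0 2 * u 1 1 - 2 * g 0 2 * g 2 0 * u 0 2.
Proof.
apply: (eq_of_subr_eq (conj1 (m := 2) (n := 2) isT)); expand_comp2.
by ring: ab.
Qed.

Lemma conj1_13 : f 1 3 =
  - b ^+ 2 * u 1 3 + a * u 1 3 - 2 * f 0 2 * u 2 1 - 2 * g 0 2 * u 1 2
  - b ^+ 2 * f 1 1 * u 1 2 - 3 * b ^+ 2 * g 1 1 * u 0 3 - b * f 1 2 * u 1 1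
  - 2 * b * g 1 2 * u 0 2 - 2 * a * f 0 3 * u 2 0 - a * g 0 3 * u 1 1
  - 2 * f 0 2 * f 1 1 * u 2 0 - f 0 2 * g 1 1 * u 1 1 - f 1 1 * g 0 2 * u 1 1
  - 2 * g 0 2 * g 1 1 * u 0 2.
Proof.
apply: (eq_of_subr_eq (conj1 (m := 1) (n := 3) isT)); expand_comp2.
by ring: ab.
Qed.

(** The next resonance, a^3 b^2 = a: [u 3 2] cancels. This is the source of [P3], and the reason for
    working up to degree 5. *)
Lemma conj1_32 : f 3 2 =
  - 2 * f 2 1 * u 2 1 - 2 * g 2 1 * u 1 2 - b ^+ 2 * f 3 0 * u 1 2
  - 3 * b ^+ 2 * g 3 0 * u 0 3 - 2 * b * f 2 0 * u 2 2 - b * f 3 1 * u 1 1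
  - 3 * b * g 2 0 * u 1 3 - 2 * b * g 3 1 * u 0 2 - 3 * a * f 1 1 * u 3 1
  - 3 * a * f 1 1 ^+ 2 * u 3 0 - 2 * a * f 2 2 * u 2 0 - 2 * a * g 1 1 * u 2 2
  - a * g 1 1 ^+ 2 * u 1 2 - a * g 2 2 * u 1 1 - 3 * a ^+ 2 * f 1 2 * u 3 0
  - a ^+ 2 * g 1 2 * u 2 1 - 4 * a ^+ 3 * f 0 2 * u 4 0
  - a ^+ 3 * g 0 2 * u 3 1 - 2 * f 0 2 * f 3 0 * u 2 0 - f 0 2 * g 3 0 * u 1 1
  - 2 * f 1 1 * f 2 1 * u 2 0 - f 1 1 * g 2 1 * u 1 1
  - 2 * f 1 2 * f 2 0 * u 2 0 - f 1 2 * g 2 0 * u 1 1 - f 2 0 * g 1 2 * u 1 1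
  - f 2 1 * g 1 1 * u 1 1 - f 3 0 * g 0 2 * u 1 1 - 2 * g 0 2 * g 3 0 * u 0 2
  - 2 * g 1 1 * g 2 1 * u 0 2 - 2 * g 1 2 * g 2 0 * u 0 2
  - 2 * b * f 1 1 * f 2 0 * u 2 1 - 2 * b * f 1 1 * g 2 0 * u 1 2
  - 2 * b * f 2 0 * g 1 1 * u 1 2 - 6 * b * g 1 1 * g 2 0 * u 0 3
  - 6 * a * f 0 2 * f 2 0 * u 3 0 - 2 * a * f 0 2 * g 2 0 * u 2 1
  - 2 * a * f 1 1 * g 1 1 * u 2 1 - 2 * a * f 2 0 * g 0 2 * u 2 1
  - 2 * a * g 0 2 * g 2 0 * u 1 2.
Proof.
apply: (eq_of_subr_eq (conj1 (m := 3) (n := 2) isT)); expand_comp2.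
by ring: ab.
Qed.

Lemma conj2_20 : g 2 0 =
  b * v 2 0 - a ^+ 2 * v 2 0.
Proof.
apply: (eq_of_subr_eq (conj2 (m := 2) (n := 0) isT)); expand_comp2.
by ring: ab.
Qed.

Lemma conj2_11 : g 1 1 =
  - v 1 1 + b * v 1 1.
Proof.
apply: (eq_of_subr_eq (conj2 (m := 1) (n := 1) isT)); expand_comp2.
by ring: ab.
Qed.

Lemma conj2_02 : g 0 2 =
  - b ^+ 2 * v 0 2 + b * v 0 2.
Proof.
apply: (eq_of_subr_eq (conj2 (m := 0) (n := 2) isT)); expand_comp2.
by ring: ab.
Qed.

(** Resonance in the second coordinate, a b^2 = b: [v 1 2] cancels. This is the source of [P2]. *)
Lemma conj2_12 : g 1 2 =
  - b * f 1 1 * v 1 1 - 2 * b * g 1 1 * v 0 2 - 2 * a * f 0 2 * v 2 0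
  - a * g 0 2 * v 1 1.
Proof.
apply: (eq_of_subr_eq (conj2 (m := 1) (n := 2) isT)); expand_comp2.
by ring: ab.
Qed.

Lemma P1_eq0 : P1 a f g = 0.
Proof.
rewrite /P1 conj1_21 conj1_11 conj1_20 conj1_02.
by ring: ab.
Qed.

Lemma P2_eq0 : P2 a f g = 0.
Proof.
rewrite /P2 conj2_12 conj2_11 conj2_20 conj2_02.
by ring: ab.
Qed.

(* The resonant coefficient u 2 1 is not determined by the lower order
   equations; it drops out only modulo P2. *)
Lemma P3_P2 : (1 - a ^+ 3) * P3 a f g =
  a ^+ 5 * (1 - a ^+ 3) ^+ 2 * (1 + a) * (1 + a ^+ 2) *
  ((1 - a ^+ 3) * (u 2 1 - 3 * u 1 1 * u 2 0) -
   a * (1 + a + a ^+ 2) * g 1 1 * u 1 1 - 2 * a * g 2 0 * u 0 2) * P2 a f g.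
Proof.
rewrite /P3 /P2 !big_ord_recl big_ord0 /=.
(* Degrees are eliminated from the top down, since each right-hand side involves only [f] of lower
   degree; the coefficients [g] stay free. *)
rewrite conj1_32 conj1_13 conj1_22 conj1_31 conj1_40 conj1_03.
rewrite conj1_12 conj1_21 conj1_30 conj1_02 conj1_11 conj1_20.
by ring: ab.
Qed.

End Obstructions.

(** * Taylor jets at the origin *)

Section Jets.
Variable K : numFieldType.
Implicit Types (P Q A B : {poly {poly K}}) (z : K * K) (h : K * K -> K).

Definition eval2 P z : K := P.[z.2%:P].[z.1].

Lemma eval2D P Q z : eval2 (P + Q) z = eval2 P z + eval2 Q z.
Proof. by rewrite /eval2 !hornerD. Qed.

Lemma eval2M P Q z : eval2 (P * Q) z = eval2 P z * eval2 Q z.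
Proof. by rewrite /eval2 !hornerM. Qed.

Lemma eval2C c z : eval2 c%:P%:P z = c.
Proof. by rewrite /eval2 !hornerC. Qed.

Lemma eval2E P z : eval2 P z =
  \sum_(j < size P) \sum_(i < size P`_j) coef2 P i j * (z.1 ^+ i * z.2 ^+ j).
Proof.
rewrite /eval2 [P.[_]]horner_coef horner_sum; apply: eq_bigr => j _.
rewrite hornerM -polyC_exp hornerC horner_coef mulr_suml.
by apply: eq_bigr => i _; rewrite mulrA.
Qed.

(** The order of [K] is only partial, so the maximum defining the norm of a pair is handled through
    comparability of real elements. *)
Lemma norm_fst_le z : `|z.1| <= `|z|.
Proof.
by rewrite prod_normE comparable_le_max ?lexx // real_comparable ?normr_real.
Qed.

Lemma norm_snd_le z : `|z.2| <= `|z|.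
Proof.
rewrite prod_normE comparable_le_max ?lexx ?orbT //.
by rewrite real_comparable ?normr_real.
Qed.

Lemma norm_pair_le z (c : K) : `|z.1| <= c -> `|z.2| <= c -> `|z| <= c.
Proof.
move=> h1 h2; rewrite prod_normE comparable_ge_max ?h1 ?h2 //.
by rewrite real_comparable ?normr_real.
Qed.

(** Every surviving monomial has degree at least [d], and powers of |z| decrease on the unit ball,
    so the sum of the |coefficients| is a valid constant. *)
Lemma eval2_bound d P : has_order d P ->
  exists2 M : K, 0 <= M & forall z, `|z| <= 1 -> `|eval2 P z| <= M * `|z| ^+ d.
Proof.
move=> hP; exists (\sum_(j < size P) \sum_(i < size P`_j) `|coef2 P i j|).
  by apply: sumr_ge0 => j _; apply: sumr_ge0.
move=> z z1; rewrite eval2E mulr_suml.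
apply: le_trans (ler_norm_sum _ _ _) _; apply: ler_sum => j _.
rewrite mulr_suml; apply: le_trans (ler_norm_sum _ _ _) _.
apply: ler_sum => i _.
have [ij|ij] := ltnP (i + j) d; first by rewrite hP // mul0r normr0 mul0r.
rewrite normrM ler_wpM2l // normrM !normrX.
apply: (@le_trans _ _ (`|z| ^+ (i + j))); last by rewrite ler_wiXn2l.
rewrite exprD ler_pM ?exprn_ge0 // lerXn2r ?nnegrE //.
  exact: norm_fst_le.
exact: norm_snd_le.
Qed.

(** [h] and [P] agree up to o(|z|^N). Terms of [P] of degree above [N] are allowed and irrelevant,
    so products and compositions need no truncation. *)
Definition jet N h P := forall e : K, 0 < e ->
  \forall z \near (0 : K * K), `|h z - eval2 P z| <= e * `|z| ^+ N.

Lemma jet_poly N P : jet N (eval2 P) P.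
Proof.
by move=> e e0; near=> z; rewrite subrr normr0 mulr_ge0 ?exprn_ge0 // ltW.
Unshelve. all: by end_near. Qed.

Lemma jet_near_eq N h h1 P :
  (\forall z \near (0 : K * K), h z = h1 z) -> jet N h P -> jet N h1 P.
Proof.
move=> hk hP e e0; near=> z.
have <- : h z = h1 z by near: z.
by near: z; exact: hP.
Unshelve. all: by end_near. Qed.

Lemma jetD N h h1 P Q : jet N h P -> jet N h1 Q ->
  jet N (fun z => h z + h1 z) (P + Q).
Proof.
move=> hP h1Q e e0; near=> z.
rewrite eval2D opprD addrACA (le_trans (ler_normD _ _)) //.
rewrite [e]splitr mulrDl lerD //; near: z.
  by apply: hP; rewrite divr_gt0.
by apply: h1Q; rewrite divr_gt0.
Unshelve. all: by end_near. Qed.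

Lemma near_norm_lt (e : K) : 0 < e -> \forall z \near (0 : K * K), `|z| < e.
Proof. by move=> e0; apply/nbhs_norm0P; exists e. Qed.

Lemma near_norm_le1 : \forall z \near (0 : K * K), `|z| <= 1.
Proof. by near=> z; apply: ltW; near: z; exact: near_norm_lt.
Unshelve. all: by end_near. Qed.

Lemma jet_bound N d h P : (d <= N)%N -> has_order d P -> jet N h P ->
  exists2 M : K, 0 < M &
    \forall z \near (0 : K * K), `|h z| <= M * `|z| ^+ d.
Proof.
(* The added 1 makes the constant positive and absorbs the remainder, taken with e = 1. *)
move=> dN /eval2_bound[M M0 hM] hP; exists (M + 1); first by rewrite ltr_wpDl.
near=> z.
have z1 : `|z| <= 1 by near: z; exact: near_norm_le1.
rewrite -[h z](subrK (eval2 P z)) (le_trans (ler_normD _ _)) //.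
rewrite addrC mulrDl lerD ?hM //.
apply: (@le_trans _ _ (1 * `|z| ^+ N)); first by near: z; exact: hP.
by rewrite !mul1r ler_wiXn2l.
Unshelve. all: by end_near. Qed.

Lemma jetM N h h1 P Q : jet N h P -> jet N h1 Q ->
  jet N (fun z => h z * h1 z) (P * Q).
Proof.
move=> hP h1Q e e0.
have ord0 (S : {poly {poly K}}) : has_order 0 S by [].
have [M M0 hM] := jet_bound (leq0n N) (ord0 Q) h1Q.
have [M' M'0 hM'] := eval2_bound (ord0 P).
(* [M'] may be zero, and a positive bound is needed as a divisor. *)
have M'1 : 0 < M' + 1 by rewrite ltr_wpDl.
near=> z.
have z1 : `|z| <= 1 by near: z; exact: near_norm_le1.
have -> : h z * h1 z - eval2 (P * Q) z =
    (h z - eval2 P z) * h1 z + eval2 P z * (h1 z - eval2 Q z).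
  by rewrite eval2M; ring.
rewrite (le_trans (ler_normD _ _)) // !normrM [e]splitr mulrDl lerD //.
  apply: (@le_trans _ _ (e / 2 / M * `|z| ^+ N * M)).
    apply: ler_pM => //.
      by near: z; apply: hP; rewrite !divr_gt0.
    by apply: (@le_trans _ _ (M * `|z| ^+ 0)); [near: z | rewrite expr0 mulr1].
  by rewrite mulrAC divfK ?gt_eqF.
apply: (@le_trans _ _ ((M' + 1) * (e / 2 / (M' + 1) * `|z| ^+ N))).
  apply: ler_pM => //.
    by rewrite (le_trans (hM' z z1)) // expr0 mulr1 lerDl.
  by near: z; apply: h1Q; rewrite !divr_gt0.
by rewrite mulrA [(M' + 1) * _]mulrC divfK ?gt_eqF.
Unshelve. all: by end_near. Qed.

Lemma jetC N c : jet N (fun=> c) c%:P%:P.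
Proof.
move=> e e0; near=> z.
by rewrite eval2C subrr normr0 mulr_ge0 ?exprn_ge0 // ltW.
Unshelve. all: by end_near. Qed.

Lemma jet_sum N (I : Type) (r : seq I) (h : I -> K * K -> K)
    (P : I -> {poly {poly K}}) :
  (forall i, jet N (h i) (P i)) ->
  jet N (fun z => \sum_(i <- r) h i z) (\sum_(i <- r) P i).
Proof.
move=> hP; elim: r => [|i r IH].
  have -> : \sum_(i <- [::]) P i = (0 : K)%:P%:P by rewrite big_nil !polyC0.
  by apply: jet_near_eq (jetC N 0); near=> z; rewrite big_nil.
rewrite big_cons; apply: jet_near_eq (jetD (hP i) IH).
by near=> z; rewrite big_cons.
Unshelve. all: by end_near. Qed.

Lemma jetX N h P n : jet N h P -> jet N (fun z => h z ^+ n) (P ^+ n).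
Proof.
move=> hP; elim: n => [|n IH].
  by rewrite expr0; exact: (jetC N 1).
rewrite exprS; apply: jet_near_eq (jetM hP IH).
by near=> z; rewrite exprS.
Unshelve. all: by end_near. Qed.

Lemma jet_map_linear_bound N A B (F : K * K -> K * K) :
  (0 < N)%N -> has_order 1 A -> has_order 1 B ->
  jet N (fun z => (F z).1) A -> jet N (fun z => (F z).2) B ->
  exists2 C : K, 0 < C & \forall z \near (0 : K * K), `|F z| <= C * `|z|.
Proof.
move=> N0 hA hB FA FB.
have [M1 M10 h1] := jet_bound N0 hA FA.
have [M2 M20 h2] := jet_bound N0 hB FB.
exists (M1 + M2); first by rewrite addr_gt0.
near=> z; apply: norm_pair_le.
  apply: (@le_trans _ _ (M1 * `|z| ^+ 1)); first by near: z.
  by rewrite expr1 ler_wpM2r // lerDl ltW.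
apply: (@le_trans _ _ (M2 * `|z| ^+ 1)); first by near: z.
by rewrite expr1 ler_wpM2r // lerDr ltW.
Unshelve. all: by end_near. Qed.

Lemma cvg0_of_linear_bound (F : K * K -> K * K) (C : K) : 0 < C ->
  (\forall z \near (0 : K * K), `|F z| <= C * `|z|) ->
  F @ (0 : K * K) --> (0 : K * K).
Proof.
move=> C0 hF; apply/cvgr0Pnorm_lt => e e0; near=> z.
apply: (@le_lt_trans _ _ (C * `|z|)); first by near: z.
rewrite mulrC -ltr_pdivlMr //; near: z.
by apply: near_norm_lt; rewrite divr_gt0.
Unshelve. all: by end_near. Qed.

(** As F(z) = O(|z|), the error h(F z) - P(F z) is o(|F z|^N), hence o(|z|^N); and P(F z) is a
    polynomial in the coordinates of F, covered by sums and products of jets. *)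
Lemma jet_comp N h P A B (F : K * K -> K * K) :
  (0 < N)%N -> has_order 1 A -> has_order 1 B ->
  jet N h P -> jet N (fun z => (F z).1) A -> jet N (fun z => (F z).2) B ->
  jet N (fun z => h (F z)) (comp2 P A B).
Proof.
move=> N0 hA hB hP FA FB.
have [C C0 hC] := jet_map_linear_bound N0 hA hB FA FB.
have Fcvg := cvg0_of_linear_bound C0 hC.
have jP : jet N (fun z => eval2 P (F z)) (comp2 P A B).
  apply: jet_near_eq (_ : jet N (fun z => \sum_(j < size P)
    \sum_(i < size P`_j) coef2 P i j * ((F z).1 ^+ i * (F z).2 ^+ j)) _).
    by near=> z; rewrite eval2E.
  apply: jet_sum => j; apply: jet_sum => i.
  by apply: jetM; [exact: jetC | apply: jetM; exact: jetX].
move=> e e0; near=> z.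
rewrite -[h (F z)](subrK (eval2 P (F z))) -addrA.
rewrite (le_trans (ler_normD _ _)) // [e]splitr mulrDl lerD //; last first.
  by near: z; apply: jP; rewrite divr_gt0.
apply: (@le_trans _ _ (e / 2 / C ^+ N * `|F z| ^+ N)).
  near: z; apply: (Fcvg _ (hP _ _)).
  by rewrite !divr_gt0 ?exprn_gt0.
apply: (@le_trans _ _ (e / 2 / C ^+ N * (C * `|z|) ^+ N)).
  apply: ler_wpM2l; first by rewrite !divr_ge0 ?exprn_ge0 // ltW.
  have FC : `|F z| <= C * `|z| by near: z.
  by apply: lerXn2r => //; rewrite nnegrE ?mulr_ge0 ?(ltW C0).
by rewrite exprMn mulrA divfK // expf_neq0 ?gt_eqF.
Unshelve. all: by end_near. Qed.


Lemma jet_weaken d N h P : (d <= N)%N -> jet N h P -> jet d h P.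
Proof.
move=> dN hP e e0; near=> z.
have z1 : `|z| <= 1 by near: z; exact: near_norm_le1.
apply: (@le_trans _ _ (e * `|z| ^+ N)); first by near: z; exact: hP.
by rewrite ler_wpM2l ?ler_wiXn2l // ltW.
Unshelve. all: by end_near. Qed.

Lemma jet0_of_order d P : has_order d.+1 P -> jet d (fun=> 0) P.
Proof.
move=> /eval2_bound[M M0 hM] e e0; near=> z.
have z1 : `|z| <= 1 by near: z; exact: near_norm_le1.
rewrite sub0r normrN (le_trans (hM z z1)) // exprS mulrA.
rewrite ler_wpM2r ?exprn_ge0 //.
have M1 : 0 < M + 1 by rewrite ltr_wpDl.
apply: (@le_trans _ _ ((M + 1) * `|z|)); first by rewrite ler_wpM2r // lerDl.
rewrite mulrC -ler_pdivlMr //; apply: ltW; near: z; apply: near_norm_lt.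
by rewrite divr_gt0 // ltr_wpDl.
Unshelve. all: by end_near. Qed.

(** * Homogeneous parts and uniqueness of jets *)

Definition hom_part d P : {poly {poly K}} :=
  \sum_(i < d.+1) (coef2 P i (d - i))%:P%:P * ('X%:P ^+ i * 'X ^+ (d - i)).

Lemma coef2_hom_part d P m n :
  coef2 (hom_part d P) m n = if (m + n == d)%N then coef2 P m n else 0.
Proof.
have coefXY i j : coef2 ('X%:P ^+ i * 'X ^+ j : {poly {poly K}}) m n =
    ((m == i) && (n == j))%:R.
  rewrite /coef2 -polyC_exp coefCM coefXn.
  by case: (n == j); rewrite ?mulr1 ?mulr0 ?coefXn ?coef0 ?andbT ?andbF.
rewrite coef2_sum; under eq_bigr do rewrite coef2Z coefXY.
case: eqP => [mn|mn]; last first.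
  rewrite big1 // => i _; case: eqP => [mi|_]; last by rewrite mulr0.
  case: eqP => [ni|_]; last by rewrite mulr0.
  by case: mn; rewrite mi ni subnKC // -ltnS.
have md : (m < d.+1)%N by rewrite ltnS -mn leq_addr.
have dm : (d - m = n)%N by rewrite -mn addKn.
rewrite (bigD1 (Ordinal md)) //= dm !eqxx mulr1 big1 ?addr0 // => i im.
by rewrite [m == i]eq_sym -[m]/(val (Ordinal md)) val_eqE (negPf im) mulr0.
Qed.

Lemma eval2_hom_part d P z : eval2 (hom_part d P) z =
  \sum_(i < d.+1) coef2 P i (d - i) * (z.1 ^+ i * z.2 ^+ (d - i)).
Proof.
rewrite /eval2 !horner_sum; apply: eq_bigr => i _.
by rewrite !(hornerM, hornerC, horner_exp, hornerX).
Qed.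

Lemma eval2_hom_partZ d P (t : K) z :
  eval2 (hom_part d P) (t *: z) = t ^+ d * eval2 (hom_part d P) z.
Proof.
rewrite !eval2_hom_part mulr_sumr; apply: eq_bigr => i _ /=.
have id : (i <= d)%N by rewrite -ltnS.
have -> : t ^+ d = t ^+ i * t ^+ (d - i) by rewrite -exprD subnKC.
by rewrite !exprMn; ring.
Qed.

(** The degree [d] part is o(|w|^d), yet along the ray through [z] it scales exactly by t^d, which
    forces it to vanish. *)
Lemma jet0_hom_part d P z : jet d (fun=> 0) P -> has_order d P ->
  eval2 (hom_part d P) z = 0.
Proof.
move=> jP oP; set H := hom_part d P.
have jH : jet d (fun=> 0) H.
  (* [P] has order [d], so it differs from its degree [d] part only by terms of order d + 1, which
     are negligible. *)
  have oQ : has_order d.+1 (H + (- 1)%:P%:P * P).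
    move=> m n mn; rewrite coef2D coef2Z coef2_hom_part mulN1r.
    case: eqP => [_|/eqP nd]; first exact: subrr.
    by rewrite oP ?oppr0 ?addr0 // ltn_neqAle nd -ltnS.
  have -> : H = (H + (- 1)%:P%:P * P) + P.
    by rewrite !polyCN !polyC1 mulN1r subrK.
  apply: jet_near_eq (jetD (jet0_of_order oQ) jP).
  by near=> w; rewrite addr0.
apply/eqP; rewrite -normr_eq0; apply: contraT => v0.
have {v0} v_gt0 : 0 < `|eval2 H z| by rewrite lt_def v0 /=.
set v := eval2 H z in v_gt0 *; set W := `|z| + 1.
have W0 : 0 < W by rewrite ltr_wpDl.
(* Scaling [z] by [del / W] brings it into the ball where the bound for this constant holds;
   cancelling (del / W)^d then leaves |v| <= |v| / 2. *)
have e0 : 0 < `|v| / 2 / W ^+ d by rewrite !divr_gt0 ?exprn_gt0.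
have /nbhs_norm0P[del /= del0 hdel] := jH _ e0.
have t0 : 0 < del / W by rewrite divr_gt0.
have zW : `|z| < W by rewrite ltrDl.
have /hdel : `|(del / W) *: z| < del.
  by rewrite prod_norm_scale gtr0_norm // mulrAC ltr_pdivrMr // ltr_pM2l.
rewrite sub0r normrN eval2_hom_partZ normrM normrX prod_norm_scale exprMn.
rewrite mulrCA (gtr0_norm t0) ler_pM2l ?exprn_gt0 // -/v.
move=> le; suff : `|v| <= `|v| / 2.
  by move=> /le_gtF; rewrite ltr_pdivrMr // ltr_pMr // ltr1n.
apply: le_trans le _; rewrite mulrAC ler_pdivrMr ?exprn_gt0 //.
apply: ler_wpM2l; first by rewrite divr_ge0.
by apply: lerXn2r; rewrite ?nnegrE // ltW.
Unshelve. all: by end_near. Qed.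

(** In characteristic 0 the natural numbers supply more distinct roots than a nonzero polynomial can
    have. *)
Lemma poly_vanishing_eq0 (r : {poly K}) : (forall x, r.[x] = 0) -> r = 0.
Proof.
move=> r0; apply/eqP; apply: contraT => nz_r.
have := @max_poly_roots _ r [seq i%:R | i <- iota 0 (size r)] nz_r.
rewrite size_map size_iota ltnn; apply.
  by apply/allP => x _; apply/eqP/r0.
by rewrite map_inj_uniq ?iota_uniq // => i j /eqP; rewrite eqr_nat => /eqP.
Qed.

Lemma jet0_has_order N P : jet N (fun=> 0) P -> has_order N.+1 P.
Proof.
move=> jP; suff H d : (d <= N.+1)%N -> has_order d P by exact: H.
elim: d => [//|d IH] dN m n; rewrite ltnS leq_eqVlt => /orP[/eqP mn|];
  last exact: IH (ltnW dN) _ _.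
(* The degree [d] part dehomogenized at y = 1, where it vanishes as a function of x. *)
pose r := \poly_(i < d.+1) coef2 P i (d - i).
have r0 : r = 0.
  apply: poly_vanishing_eq0 => x.
  have := jet0_hom_part (x, 1) (jet_weaken (dN : (d <= N)%N) jP) (IH (ltnW dN)).
  rewrite eval2_hom_part horner_poly /= => {2}<-.
  by apply: eq_bigr => i _; rewrite expr1n mulr1.
have : r`_m = 0 by rewrite r0 coef0.
by rewrite coef_poly ltnS -mn leq_addr addKn.
Qed.

Lemma coef2_comp2E N A B P s t u :
  s 0%N 0%N = 0 -> t 0%N 0%N = 0 ->
  (forall i j, (i + j <= N)%N -> coef2 P i j = u i j) ->
  (forall i j, (i + j <= N)%N -> coef2 A i j = s i j) ->
  (forall i j, (i + j <= N)%N -> coef2 B i j = t i j) ->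
  forall m n, (m + n <= N)%N -> coef2 (comp2 P A B) m n = comp2_coef u s t m n.
Proof.
move=> s0 t0 hP hA hB m n mn.
have oA : has_order 1 A by move=> [|i] [|j] //; rewrite hA.
have oB : has_order 1 B by move=> [|i] [|j] //; rewrite hB.
rewrite (coef2_comp2 P oA oB (leqnn _)) /comp2_coef csumE.
apply: eq_bigr => j _; rewrite csumE; apply: eq_bigr => i _.
rewrite (coef2_monomE hA hB) // hP // (leq_trans _ mn) //.
have jmn : (j <= m + n)%N by rewrite -ltnS.
by rewrite addnC -leq_subRL // -ltnS.
Qed.

(** * Linearization by averaging over the iterates *)

Lemma sum_cyclic_shift (V : zmodType) (G : nat -> V) p : G p = G 0%N ->
  \sum_(k < p) G k.+1 = \sum_(k < p) G k.
Proof.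
move=> Gp; apply: (addIr (G 0%N)).
transitivity (\sum_(k < p.+1) G k); first by rewrite big_ord_recl addrC.
by rewrite big_ord_recr /= Gp.
Qed.

(** The eigenvalue conditions on the linear part of [h] make it survive the averaging unchanged.
    Only the jet of the average is retained. *)
Lemma exists_linearization N A B (F : K * K -> K * K) h P (a b l : K) p :
  (0 < N)%N -> (0 < p)%N -> l ^+ p = 1 ->
  coef2 A 0 0 = 0 -> coef2 A 1 0 = a -> coef2 A 0 1 = 0 ->
  coef2 B 0 0 = 0 -> coef2 B 1 0 = 0 -> coef2 B 0 1 = b ->
  jet N (fun z => (F z).1) A -> jet N (fun z => (F z).2) B ->
  (\forall z \near (0 : K * K), iter p F z = z) ->
  jet N h P -> coef2 P 0 0 = 0 ->
  a * coef2 P 1 0 = l * coef2 P 1 0 -> b * coef2 P 0 1 = l * coef2 P 0 1 ->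
  exists2 Q, [/\ coef2 Q 0 0 = 0, coef2 Q 1 0 = coef2 P 1 0
      & coef2 Q 0 1 = coef2 P 0 1] &
    forall m n, (m + n <= N)%N -> coef2 (comp2 Q A B) m n = l * coef2 Q m n.
Proof.
move=> N0 p0 lp A00 A10 A01 B00 B10 B01 FA FB Fp hP P00 Px Py.
have oA : has_order 1 A by case=> [|i] [|j].
have oB : has_order 1 B by case=> [|i] [|j].
have l0 : l != 0.
  apply/eqP => l0; move/eqP: lp.
  by rewrite l0 expr0n gtn_eqF // eq_sym oner_eq0.
have p_neq0 : p%:R != 0 :> K by rewrite pnatr_eq0 -lt0n.
pose Pk k := iter k (fun Q => comp2 Q A B) P.
have jPk k : jet N (fun z => h (iter k F z)) (Pk k).
  elim: k => [//|k IH].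
  apply: jet_near_eq (jet_comp N0 oA oB IH FA FB).
  by near=> z; rewrite iterSr.
have lin k : [/\ coef2 (Pk k) 0 0 = 0, coef2 (Pk k) 1 0 = l ^+ k * coef2 P 1 0
    & coef2 (Pk k) 0 1 = l ^+ k * coef2 P 0 1].
  elim: k => [|k [IH0 IH1 IH2]]; first by rewrite !expr0 !mul1r.
  have E := @coef2_comp2E N A B (Pk k) _ _ _ A00 B00
    (fun _ _ _ => erefl) (fun _ _ _ => erefl) (fun _ _ _ => erefl).
  have lins := (A00, A10, A01, B00, B10, B01, IH0, IH1, IH2).
  split; rewrite /= E //; expand_comp2; rewrite ?lins.
  - by ring.
  - transitivity (l ^+ k * (a * coef2 P 1 0)); first by ring.
    by rewrite Px exprS; ring.
  - transitivity (l ^+ k * (b * coef2 P 0 1)); first by ring.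
    by rewrite Py exprS; ring.
(* The weight l^-k undoes the factor l^k that k iterations put on the linear part, so the average
   keeps the linear part of [h]. *)
pose c k := l ^- k / p%:R.
pose phi z := \sum_(k < p) c k * h (iter k F z).
pose Q := \sum_(k < p) (c k)%:P%:P * Pk k.
have jQ : jet N phi Q by apply: jet_sum => k; exact: jetM (jetC _ _) (jPk _).
have sumc : \sum_(k < p) c k * l ^+ k = 1.
  rewrite (eq_bigr (fun=> p%:R^-1)); last first.
    by move=> k _; rewrite /c mulrAC mulVf ?mul1r // expf_neq0.
  by rewrite sumr_const card_ord -[_ *+ p]mulr_natr mulVf.
exists Q.
  split; rewrite coef2_sum.
  - rewrite big1 // => k _; rewrite coef2Z.
    by case: (lin k) => -> _ _; rewrite mulr0.
  - rewrite -[RHS]mul1r -sumc mulr_suml; apply: eq_bigr => k _.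
    by rewrite coef2Z; case: (lin k) => _ -> _; exact: mulrA.
  - rewrite -[RHS]mul1r -sumc mulr_suml; apply: eq_bigr => k _.
    by rewrite coef2Z; case: (lin k) => _ _ ->; exact: mulrA.
(* Near 0 the function phi o F - l phi is zero, so by uniqueness of jets its polynomial has no
   coefficient of degree at most [N]. *)
have j0 : jet N (fun=> 0) (comp2 Q A B + (- l)%:P%:P * Q).
  have jlQ := jetM (jetC N (- l)) jQ.
  apply: jet_near_eq (jetD (jet_comp N0 oA oB jQ FA FB) jlQ).
  near=> z; have zp : iter p F z = z by near: z.
  apply/eqP; rewrite mulNr subr_eq0; apply/eqP.
  (* Since l c_(k+1) = c_k, applying F shifts the index of [G]; the shift closes up because F^p = id
     near 0 and l^p = 1. *)
  pose G k := l * (c k * h (iter k F z)).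
  have -> : phi (F z) = \sum_(k < p) G k.+1.
    apply: eq_bigr => k _; rewrite /G iterSr /c exprS invfM.
    by field; rewrite l0 p_neq0 expf_neq0.
  have -> : l * phi z = \sum_(k < p) G k by rewrite mulr_sumr.
  have Gp : G p = G 0%N by rewrite /G /c zp lp expr0.
  exact: sum_cyclic_shift.
move=> m n mn; have := jet0_has_order j0 (i := m) (j := n) mn.
by rewrite coef2D coef2Z => /eqP; rewrite mulNr subr_eq0 => /eqP.
Unshelve. all: by end_near. Qed.

End Jets.

(** * Periodic maps *)

Lemma jet_of_expansion (R : realType) (h : C2 R -> Cx R) (a b : Cx R)
    (c : nat -> nat -> Cx R) : has_expansion h a b c ->
  exists2 A : {poly {poly Cx R}}, jet 5 h A &
    forall i j, (i + j <= 5)%N -> coef2 A i j = lin_coef a b c i j.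
Proof.
move=> /(_ 5) /eqoP hc.
(* Cutting off above degree 5 makes the sum over the 6 by 6 square agree with the truncated
   expansion. *)
pose s i j := if (i + j <= 5)%N then lin_coef a b c i j else 0.
exists (\poly_(j < 6) \poly_(i < 6) s i j); last first.
  move=> i j ij; rewrite /coef2 coef_poly ltnS (leq_trans (leq_addl i j) ij).
  by rewrite coef_poly ltnS (leq_trans (leq_addr j i) ij) /s ij.
move=> e e0; have he := hc _ e0; near=> z.
suff -> : eval2 (\poly_(j < 6) \poly_(i < 6) s i j) z = a * z.1 + b * z.2 +
    \sum_(i < 6) \sum_(j < 6 | (2 <= i + j <= 5)%N)
       c i j * z.1 ^+ i * z.2 ^+ j.
  by rewrite -[`|z| ^+ 5]ger0_norm ?exprn_ge0 //; near: z.
have -> : eval2 (\poly_(j < 6) \poly_(i < 6) s i j) z =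
    \sum_(j < 6) \sum_(i < 6) s i j * z.1 ^+ i * z.2 ^+ j.
  rewrite /eval2 horner_poly horner_sum; apply: eq_bigr => j _.
  by rewrite -polyC_exp hornerM hornerC horner_poly mulr_suml.
under [in RHS]eq_bigr do rewrite big_mkcond.
rewrite !big_ord_recl !big_ord0 /= /bump /= /s /lin_coef /=.
ring.
Unshelve. all: by end_near. Qed.

(** Each iterate is continuous at the fixed point, so points near it stay in [U] for [p] steps;
    periodicity then gives F^p = id on a full neighbourhood. *)
Lemma near_iter_defined (T : topologicalType) (x : T) (U : set T)
    (F : T -> T) p :
  open U -> U x -> F @ x --> x ->
  \forall z \near x, iter_defined U F p z.
Proof.
move=> oU Ux Fx.
have iterF k : iter k F @ x --> x.
  by elim: k => [|k IH]; [exact: cvg_id | exact: cvg_comp IH Fx].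
elim: p => [|p IH]; first by near=> z.
near=> z => k; rewrite ltnS leq_eqVlt => /orP[/eqP->|].
  near: z; apply: iterF; exact: open_nbhs_nbhs.
by move: k; near: z.
Unshelve. all: by end_near. Qed.

Theorem theorem1 (R : realType) (p : nat) (hp : (5 <= p)%N)
    (alpha : Cx R) (halpha : p.-primitive_root alpha)
    (f g : nat -> nat -> Cx R)
    (U : set (C2 R)) (F : C2 R -> C2 R)
    (hU : open U) (U0 : U 0) (F0 : F 0 = 0)
    (Fsmooth : smooth_on U F)
    (F1 : has_expansion (fun z => (F z).1) alpha 0 f)
    (F2 : has_expansion (fun z => (F z).2) 0 alpha^-1 g)
    (Fper : periodic_map U F p) :
  [/\ P1 alpha f g = 0, P2 alpha f g = 0 & P3 alpha f g = 0].
Proof.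
have [p0 Fid _] := Fper.
have ap := prim_expr_order halpha.
have a0 : alpha != 0.
  apply/eqP => a0; move/eqP: ap.
  by rewrite a0 expr0n gtn_eqF // eq_sym oner_eq0.
have [A FA cA] := jet_of_expansion F1.
have [B FB cB] := jet_of_expansion F2.
have oA : has_order 1 A by case=> [|i] [|j] // _; rewrite cA.
have oB : has_order 1 B by case=> [|i] [|j] // _; rewrite cB.
have Fp : \forall z \near (0 : C2 R), iter p F z = z.
  have [C C0 FC] := jet_map_linear_bound (isT : (0 < 5)%N) oA oB FA FB.
  have Fcvg := cvg0_of_linear_bound C0 FC.
  have Udef := near_iter_defined p hU U0 Fcvg.
  near=> z; apply: Fid; near: z.
  exact: Udef.
have lin h P l (lp : l ^+ p = 1) (hP : jet 5 h P) :=
  exists_linearization (isT : (0 < 5)%N) p0 lp (cA 0 0 isT) (cA 1 0 isT)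
    (cA 0 1 isT) (cB 0 0 isT) (cB 1 0 isT) (cB 0 1 isT) FA FB Fp hP.
(* The coordinate x is averaged with eigenvalue [alpha]; below, y is averaged with [alpha^-1]. *)
have [|||Q [Q00 Q10 Q01] cQ] := lin _ _ _ ap (jet_poly _ 'X%:P).
- by rewrite coef2_X.
- by [].
- by rewrite coef2_X !mulr0.
have ip : alpha^-1 ^+ p = 1 by rewrite exprVn ap invr1.
have [|||S [S00 S10 S01] cS] := lin _ _ _ ip (jet_poly _ 'X).
- by rewrite coef2_Y.
- by rewrite coef2_Y !mulr0.
- by [].
rewrite !coef2_X !coef2_Y /= in Q10 Q01 S10 S01.
have linQ i j : coef2 Q i j = lin_coef 1 0 (coef2 Q) i j.
  by case: i j => [|[|i]] [|[|j]].
have linS i j : coef2 S i j = lin_coef 0 1 (coef2 S) i j.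
  by case: i j => [|[|i]] [|[|j]].
have ab : alpha * alpha^-1 = 1 by rewrite mulfV.
have conj1 m n : (m + n <= 5)%N ->
    comp2_coef (lin_coef 1 0 (coef2 Q)) (lin_coef alpha 0 f)
      (lin_coef 0 alpha^-1 g) m n = alpha * lin_coef 1 0 (coef2 Q) m n.
  move=> mn; rewrite -linQ -cQ //; symmetry.
  exact: (coef2_comp2E (erefl _) (erefl _) (fun i j _ => linQ i j) cA cB mn).
have conj2 m n : (m + n <= 5)%N ->
    comp2_coef (lin_coef 0 1 (coef2 S)) (lin_coef alpha 0 f)
      (lin_coef 0 alpha^-1 g) m n = alpha^-1 * lin_coef 0 1 (coef2 S) m n.
  move=> mn; rewrite -linS -cS //; symmetry.
  exact: (coef2_comp2E (erefl _) (erefl _) (fun i j _ => linS i j) cA cB mn).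
have P2_0 := P2_eq0 ab conj2.
split; [exact: P1_eq0 ab conj1 | exact: P2_0 |].
have := P3_P2 ab conj1; rewrite P2_0 mulr0 => /eqP.
rewrite mulf_eq0 => /orP[|/eqP//].
(* The factor 1 - alpha^3 is nonzero: otherwise [p] would divide 3, against p >= 5. *)
rewrite subr_eq0 eq_sym -(prim_order_dvd halpha) => /dvdn_leq.
by move=> /(_ isT); rewrite leqNgt (leq_trans _ hp).
Unshelve. all: by end_near. Qed.
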